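(* For every even integer $q\ge 2$, there exists a code $C'\subseteq B_q^4$ capable of correcting single deletions that is perfect, i.e. $\lfloor C'\rfloor_1=B_q^3$, and optimal, i.e. $|C'|=N(4,q,1)=\dfrac{q^2(q+2)}{4}$.
   Context: $B_q=\{0,\dots,q-1\}$ and $B_q^n$ is the set of words of length $n$ over $B_q$. For a word $x$, $\lfloor x\rfloor_1$ is the set of words obtained from $x$ by deleting one letter, and $\lfloor C\rfloor_1=\bigcup_{x\in C}\lfloor x\rfloor_1$. A code $C\subseteq B_q^4$ is capable of correcting single deletions if the sets $\lfloor x\rfloor_1$ ($x\in C$) are pairwise disjoint; it is perfect if moreover $\lfloor C\rfloor_1=\lfloor B_q^4\rfloor_1=B_q^3$. $N(4,q,1)$ is the maximum cardinality of a code in $B_q^4$ capable of correcting single deletions. *)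

(* Defs.v *)
From mathcomp Require Import all_boot.
Set Implicit Arguments. Unset Strict Implicit. Unset Printing Implicit Defensive.

Definition word (n q : nat) := (n.-tuple 'I_q).

Definition del1_seq (T : Type) (x : seq T) : seq (seq T) :=
  [seq take i x ++ drop i.+1 x | i <- iota 0 (size x)].

Definition del1 (n q : nat) (x : word n.+1 q) : {set word n q} :=
  [set y : word n q | val y \in del1_seq (val x)].

Definition del1_code (n q : nat) (C : {set word n.+1 q}) : {set word n q} :=
  \bigcup_(x in C) del1 x.

Definition corrects1 (n q : nat) (C : {set word n.+1 q}) : bool :=
  [forall x in C, forall y in C, (x != y) ==> [disjoint del1 x & del1 y]].

Definition perfect1 (n q : nat) (C : {set word n.+1 q}) : bool :=
  corrects1 C && (del1_code C == del1_code [set: word n.+1 q]).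

(* N(n+1, q, 1): maximum cardinality of a single-deletion-correcting code in B_q^{n+1}. *)
Definition N1 (n q : nat) : nat :=
  \max_(C : {set word n.+1 q} | corrects1 C) #|C|.

(* Main.v *)
Require Import Defs.
From mathcomp Require Import all_boot all_algebra.
From mathcomp Require Import zify ring.
Set Implicit Arguments. Unset Strict Implicit. Unset Printing Implicit Defensive.
Import GRing.Theory.

(* Upper bound: give the triple abc the weight (1 + [a = b])(1 + [b = c]), of total
   q(q+1)^2. The triples deleted from a word have total weight at least 4 plus the number
   of letters a for which an odd number of the triples aba, b <> a, is deleted from it.
   As q is even, each letter a has an odd number q-1 of triples aba, so it either leaves
   one of them uncovered or lies in such an odd word; hence 4|C| + q <= q(q+1)^2.

   Construction: fix a fixed-point-free involution f of the alphabet and take the words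
   aaaa, aabb with b <> f a, and abba with b = f a. What remains are the triples of
   distinct letters and the triples aba with b <> f a; a "design" covers each of them once
   by words abcd of distinct letters and words abca. Designs are built recursively: on 2g
   letters from g; and on 3g + s letters, viewed as three copies of Z/g plus a stem of s
   letters, from a design on g + s letters which has the stem as a subdesign, for
   s = 0, 2, 4. With computed designs on 6, 10 and 18 letters these steps reach every
   even q. *)

(** * Deletions and the upper bound *)

(** The tripling is governed by a count. For letters x, x' of one part and y of another, the triples
    [xyx'] are classified by the difference x' - x, and each of the g differences, 0 included, must
    be consumed once: as the shift of an oriented factor, or by a pair of sums {a, a + d}. A stem of
    s letters takes s of the g sums; the other g - s sums, paired once for each of the two cyclic
    orders of the parts, realize g - s differences, and s oriented factors supply the rest. The two
    orders must realize disjoint sets of differences, and this is what the explicit involutions on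
    Z/g are chosen for. A sum is never paired with itself, so difference 0 never comes from a pair;
    for s = 0 the sums and differences 0 and h are therefore removed together, which is the role of
    the cubes. A stem of four letters has to be a subdesign, so the induction must produce one each
    time: the factor pairing x with x + h receives the shifts 0 and h, and then the letters 0 and h
    of two parts form a closed set. *)

Ltac decide_eqs :=
  rewrite /= ?inE ?xpair_eqE ?eqxx /=;
  repeat match goal with
  | H : is_true (?x != ?x) |- _ => by rewrite eqxx in H
  | H : is_true (?x != ?y) |- context [?x == ?y] => rewrite (negbTE H) /=
  | H : is_true (?x != ?y) |- context [?y == ?x] => rewrite [y == x]eq_sym (negbTE H) /=
  end; rewrite ?andbF /= ?big_cons ?big_nil /= ?eqxx /=;
  repeat match goal with
  | H : is_true (?x != ?y) |- context [?x == ?y] => rewrite (negbTE H) /=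
  | H : is_true (?x != ?y) |- context [?y == ?x] => rewrite [y == x]eq_sym (negbTE H) /=
  end; rewrite ?eqxx ?andbF /=; try done.

Section Triples.
Variable T : Type.
Definition dels (w : T * T * T * T) : seq (T * T * T) :=
  let: (a, b, c, d) := w in [:: (b, c, d); (a, c, d); (a, b, d); (a, b, c)].
Definition map3 (U : Type) (g : T -> U) (t : T * T * T) : U * U * U :=
  let: (a, b, c) := t in (g a, g b, g c).
Definition map4 (U : Type) (g : T -> U) (w : T * T * T * T) : U * U * U * U :=
  let: (a, b, c, d) := w in (g a, g b, g c, g d).
End Triples.

Section Words.
Variable q : nat.
Notation L := 'I_q.

Definition tup3 (t : L * L * L) : word 3 q := [tuple t.1.1; t.1.2; t.2].
Definition tup4 (w : L * L * L * L) : word 4 q :=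
  [tuple w.1.1.1; w.1.1.2; w.1.2; w.2].
Definition of3 (y : word 3 q) : L * L * L :=
  (tnth y (inord 0), tnth y (inord 1), tnth y (inord 2)).
Definition of4 (x : word 4 q) : L * L * L * L :=
  (tnth x (inord 0), tnth x (inord 1), tnth x (inord 2), tnth x (inord 3)).

Lemma tup3K : cancel tup3 of3.
Proof. by case=> [[a b] c]; rewrite /of3 !(tnth_nth a) !inordK. Qed.

Lemma of3K : cancel of3 tup3.
Proof.
case=> [[|a [|b [|c [|]]]] // hs]; apply: val_inj => /=.
by rewrite !(tnth_nth a) !inordK.
Qed.

Lemma tup4K : cancel tup4 of4.
Proof. by case=> [[[a b] c] d]; rewrite /of4 !(tnth_nth a) !inordK. Qed.

Lemma of4K : cancel of4 tup4.
Proof.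
case=> [[|a [|b [|c [|d [|]]]]] // hs]; apply: val_inj => /=.
by rewrite !(tnth_nth a) !inordK.
Qed.

Lemma mem_del1 t w : (tup3 t \in del1 (tup4 w)) = (t \in dels w).
Proof.
case: t w => [[x y] z] [[[a b] c] d].
by rewrite inE /del1_seq /= !inE !eqseq_cons !xpair_eqE !andbT !andbA.
Qed.

Lemma mem_del1_of (y : word 3 q) (x : word 4 q) :
  (y \in del1 x) = (of3 y \in dels (of4 x)).
Proof. by rewrite -mem_del1 of3K of4K. Qed.

Lemma sum_words3 (F : L * L * L -> nat) :
  \sum_(y : word 3 q) F (of3 y) = \sum_a \sum_b \sum_c F (a, b, c).
Proof.
rewrite (reindex tup3) /=; last by exists of3 => y _; rewrite ?tup3K ?of3K.
under eq_bigr do rewrite tup3K.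
rewrite pair_bigA pair_bigA /=.
by apply: eq_bigr => -[[a b] c].
Qed.

Lemma sum_del1 (F : L * L * L -> nat) (x : word 4 q) :
  \sum_(y in del1 x) F (of3 y) = \sum_(u <- undup (dels (of4 x))) F u.
Proof.
rewrite (reindex tup3); last by exists of3 => y _; rewrite ?tup3K ?of3K.
rewrite [RHS](big_uniq _ (undup_uniq _)).
apply: eq_big => t; last by rewrite tup3K.
by rewrite mem_undup mem_del1_of tup3K.
Qed.

Definition weight (t : L * L * L) : nat :=
  let: (a, b, c) := t in (1 + (a == b)) * (1 + (b == c)).

(** For a fixed middle letter b the sum is a product of a sum over a and a sum over c, each equal to
    q + 1. *)
Lemma sum_weight : \sum_a \sum_b \sum_c weight (a, b, c) = q * (q + 1) ^ 2.
Proof.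
rewrite exchange_big /=.
have sum1 (b : L) (r : rel L) : r =2 eq_op ->
    \sum_a (1 + r a b) = q + 1.
  move=> rE; rewrite big_split /= sum1_card card_ord; congr (_ + _).
  under eq_bigr do rewrite rE.
  by rewrite -big_mkcond /= sum1_card card1.
under eq_bigr => b _.
  under eq_bigr => a _ do rewrite -big_distrr /=.
  rewrite -big_distrl /= (sum1 b eq_op) //.
  under [X in _ * X]eq_bigr => c _ do rewrite eq_sym.
  rewrite (sum1 b eq_op) //; over.
by rewrite sum_nat_const card_ord.
Qed.

(* The triples aba with b <> a, for a given letter a, are q - 1 in number; when q is
   even they cannot all be paired by codewords of the form abca. *)
Definition alternating (l : L) (t : L * L * L) : bool :=
  let: (a, b, c) := t in [&& a == l, c == l & b != l].

Lemma sum_alternating l :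
  \sum_(y : word 3 q) alternating l (of3 y) = q.-1.
Proof.
rewrite (sum_words3 (fun t => alternating l t : nat)) (bigD1 l) //=.
rewrite [X in _ + X]big1 ?addn0; last first.
  by move=> a al; do 2 (apply: big1 => ? _); rewrite (negbTE al).
rewrite (bigD1 l) //= big1 ?add0n; last by move=> c _; rewrite eqxx /= !andbF.
rewrite (eq_bigr (fun=> 1)) => [|b bl]; last first.
  rewrite (bigD1 l) //= !eqxx bl big1 // => c cl.
  by rewrite (negbTE cl).
rewrite sum1_card; have := cardC1 l; rewrite card_ord => <-.
by apply: eq_card => b; rewrite !inE.
Qed.

(** A triple with three, two or one runs weighs 1, 2 or 4, so [aaaa], [aabb] and [abca] reach 4
    exactly. Odd letters cost more: [abba] weighs 5, and [abab], odd for both of its letters, weighs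
    6. *)
Lemma weight_dels (w : L * L * L * L) :
  4 + \sum_l odd (\sum_(u <- undup (dels w)) alternating l u)
    <= \sum_(u <- undup (dels w)) weight u.
Proof.
case: w => [[[a b] c] d].
set k := fun l => \sum_(u <- undup (dels (a, b, c, d))) alternating l u.
(* Every triple deleted from [abcd] begins with a or b, and an alternating triple begins with its
   own letter. *)
have k0 l : l != a -> l != b -> k l = 0.
  move=> la lb; rewrite /k big1_seq // => -[[x y] z].
  rewrite mem_undup /= !inE !xpair_eqE.
  case: (eqVneq x l) => [->|//]; rewrite (negbTE la) (negbTE lb) /=.
  by rewrite ?andbF ?andFb.
have -> : \sum_l odd (k l) = odd (k a) + (b != a) * odd (k b).
  rewrite (bigD1 a) //=; congr (_ + _).
  case: (eqVneq b a) => [ba|ba].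
    by rewrite big1 // => l la; rewrite k0 // ba.
  rewrite (bigD1 b) //= big1 ?addn0 ?mul1n // => l /andP[la lb].
  by rewrite k0.
rewrite /k /=.
case: (eqVneq a b) => [<-|ab]; case: (eqVneq c d) => [<-|cd].
- case: (eqVneq a c) => [<-|ac]; decide_eqs.
- case: (eqVneq a c) => [?|ac]; [subst c|]; [|case: (eqVneq a d) => [?|ad]; [subst d|]]; decide_eqs.
- case: (eqVneq b c) => [?|bc]; [subst c|case: (eqVneq a c) => [?|ac]; [subst c|]]; decide_eqs.
- case: (eqVneq b c) => [?|bc]; [subst c|case: (eqVneq a c) => [?|ac]; [subst c|]];
   (case: (eqVneq a d) => [?|ad]; [subst d|case: (eqVneq b d) => [?|bd]; [subst d|]]); decide_eqs.
Qed.
End Words.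

Section Bound.
Variable q : nat.
Notation L := 'I_q.
Hypotheses (q_gt0 : 0 < q) (q_even : ~~ odd q).

Lemma sum_del1_code (C : {set word 4 q}) (F : L * L * L -> nat) : corrects1 C ->
  \sum_(y in del1_code C) F (of3 y) =
    \sum_(x in C) \sum_(u <- undup (dels (of4 x))) F u.
Proof.
move=> /forall_inP hC.
rewrite /del1_code [\bigcup_(x in C) _]big_mkcond partition_disjoint_bigcup /=.
  rewrite [RHS]big_mkcond; apply: eq_bigr => x _.
  by case: ifP => _; rewrite ?big_set0 ?sum_del1.
move=> x y xy; case: ifP => xC; last by rewrite -setI_eq0 set0I.
case: ifP => yC; last by rewrite -setI_eq0 setI0.
by have /forall_inP/(_ _ yC)/implyP := hC _ xC; apply.
Qed.

Lemma odd_sum_le (I : finType) (A : pred I) (F : I -> nat) :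
  odd (\sum_(i in A) F i) <= \sum_(i in A) odd (F i).
Proof.
elim/big_rec2: _ => // i n m _ nm.
by rewrite oddD; case: (odd (F i)) (odd m) nm => -[]; rewrite ?add0n //; lia.
Qed.

Lemma card_corrects1_le (C : {set word 4 q}) :
  corrects1 C -> 4 * #|C| <= q ^ 2 * (q + 2).
Proof.
move=> hC; set U := del1_code C.
have splitU (F : L * L * L -> nat) : \sum_(y : word 3 q) F (of3 y) =
    \sum_(x in C) \sum_(u <- undup (dels (of4 x))) F u
    + \sum_(y in ~: U) F (of3 y).
  rewrite -sum_del1_code // -/U.
  rewrite (bigID (mem U)) /=; congr (_ + _).
  by apply: eq_bigl => y; rewrite inE.
pose k (x : word 4 q) (l : L) := \sum_(u <- undup (dels (of4 x))) alternating l u.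
have one_odd (l : L) : 1 <= \sum_(x in C) odd (k x l)
                      + \sum_(y in ~: U) alternating l (of3 y).
  have := splitU (fun u => alternating l u : nat).
  rewrite sum_alternating => e.
  have := odd_sum_le (mem C) (fun x => k x l).
  move: e; rewrite -/(k _ _).
  set S1 := \sum_(x in C) \sum_(_ <- _) _; set S2 := \sum_(y in _) _.
  set S3 := \sum_(i in _) odd _ => e.
  rewrite -/S1 => le3.
  have : odd (S1 + S2) by rewrite -e; case: (q) q_gt0 q_even => //= n _; rewrite negbK.
  case: S2 {e} => [|n]; last by lia.
  by rewrite addn0 => o; rewrite o in le3; lia.
(* An uncovered triple alternates for at most one letter and weighs at least 1, so its weight pays
   for that letter. *)
have uncov : \sum_l \sum_(y in ~: U) alternating l (of3 y)
             <= \sum_(y in ~: U) weight (of3 y).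
  rewrite exchange_big; apply: leq_sum => y _.
  case: (of3 y) => [[a b] c] /=.
  rewrite (bigD1 a) //= [X in _ + X]big1 => [|l /negbTE la].
    by rewrite addn0; case: (_ && _); case: (a == b); case: (b == c).
  by rewrite [a == l]eq_sym la.
have cov : 4 * #|C| + \sum_l \sum_(x in C) odd (k x l)
           <= \sum_(x in C) \sum_(u <- undup (dels (of4 x))) weight u.
  rewrite exchange_big /= mulnC -sum_nat_const -big_split /=.
  by apply: leq_sum => x _; apply: weight_dels.
have := splitU (@weight q); rewrite sum_words3 sum_weight => e.
have : q <= \sum_l (\sum_(x in C) odd (k x l)
                      + \sum_(y in ~: U) alternating l (of3 y)).
  apply: leq_trans (_ : \sum_(l : L) 1 <= _); first by rewrite sum1_card card_ord.
  by apply: leq_sum.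
rewrite big_split => le_q.
have q3 : q * (q + 1) ^ 2 = q ^ 2 * (q + 2) + q by nia.
rewrite q3 in e.
rewrite -(leq_add2r q) e; apply: leq_trans (leq_add cov uncov).
by rewrite -addnA leq_add2l.
Qed.
End Bound.

(** * From designs to optimal codes *)

Definition fpf_involution (L : eqType) (f : L -> L) : Prop :=
  involutive f /\ forall x, f x != x.

Definition essential (L : eqType) (f : L -> L) (t : L * L * L) : bool :=
  let: (a, b, c) := t in [&& a != b, b != c & (a != c) || (b != f a)].

(* [e] sends each essential triple to the only word of the design containing it. *)
Definition design (L : eqType) (f : L -> L) (e : L * L * L -> L * L * L * L) : Prop :=
  forall t, essential f t ->
    t \in dels (e t) /\ forall u, u \in dels (e t) -> essential f u /\ e u = e t.

Section Assembly.
Variables (q : nat) (f : 'I_q -> 'I_q) (e : 'I_q * 'I_q * 'I_q -> 'I_q * 'I_q * 'I_q * 'I_q).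
Notation L := 'I_q.
Hypotheses (q_gt0 : 0 < q) (q_even : ~~ odd q).
Hypotheses (f_inv : fpf_involution f) (e_design : design f e).

(** When c = f a the triple [aac] must go to [caac], since [aacc] is then not a codeword; similarly
    for [abb]. *)
Definition total_ext (t : L * L * L) : L * L * L * L :=
  let: (a, b, c) := t in
  if a == b then
    if b == c then (a, a, a, a) else if c == f a then (c, a, a, c) else (a, a, c, c)
  else if b == c then if b == f a then (a, b, b, a) else (a, a, b, b)
  else if (a == c) && (b == f a) then (a, b, b, a) else e t.

Lemma total_ext_essential t : essential f t -> total_ext t = e t.
Proof.
case: t => [[a b] c] /and3P[/negbTE ab /negbTE bc abc] /=.
by rewrite ab bc -[_ && _]negbK negb_and abc.
Qed.

Lemma total_ext_not_essential t : ~~ essential f t ->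
  [\/ exists a, t = (a, a, a) /\ total_ext t = (a, a, a, a),
      exists a b, [/\ a != b, b != f a, total_ext t = (a, a, b, b) & t \in dels (a, a, b, b)]
    | exists a b, [/\ b = f a, total_ext t = (a, b, b, a) & t \in dels (a, b, b, a)]].
Proof.
have [fK f_neq] := f_inv.
case: t => [[a b] c] /=.
case: (eqVneq a b) => [<-|ab] /=.
  case: (eqVneq a c) => [<-|ac] _; first by constructor 1; exists a.
  case: (eqVneq c (f a)) => [cE|cE].
    by constructor 3; exists c, a; rewrite cE fK !inE !eqxx /= ?orbT.
  by constructor 2; exists a, c; rewrite !inE !eqxx /= ?orbT.
case: (eqVneq b c) => [<-|bc] /=.
  move=> _; case: (eqVneq b (f a)) => [bE|bE].
    by constructor 3; exists a, b; rewrite !inE !eqxx /= ?orbT.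
  by constructor 2; exists a, b; rewrite !inE !eqxx /= ?orbT.
rewrite negb_or !negbK => /andP[/eqP<- /eqP bE].
by constructor 3; exists a, b; rewrite eqxx {2}bE eqxx /= !inE !eqxx /= ?orbT.
Qed.

(** Membership makes the codewords cover all triples; constancy of [total_ext] on the triples of a
    codeword makes their deletion sets disjoint. *)
Lemma total_ext_perfect t :
  t \in dels (total_ext t) /\
  forall u, u \in dels (total_ext t) -> total_ext u = total_ext t.
Proof.
have [fK f_neq] := f_inv.
case: (boolP (essential f t)) => [et|].
  rewrite total_ext_essential //; have [te tu] := e_design et.
  by split=> // u /tu[eu <-]; rewrite total_ext_essential.
move=> /total_ext_not_essential[[a [-> ->]]|[a [b [ab bf -> ->]]]|[a [b [bE -> ->]]]];
  split=> //; rewrite ?inE ?eqxx // => u; rewrite !inE.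
- by rewrite !orbb => /eqP-> /=; rewrite !eqxx.
- do 3 ?case/orP; move/eqP=> -> /=; rewrite ?eqxx ?(negbTE ab) ?(negbTE bf) //.
- have ba : (b == a) = false by rewrite bE (negbTE (f_neq a)).
  have ab : (a == b) = false by rewrite eq_sym.
  do 3 ?case/orP; move/eqP=> -> /=; rewrite ?eqxx ?ba ?ab /= bE ?fK ?eqxx //=.
Qed.

Definition codewords : {set word 4 q} := [set tup4 (total_ext t) | t : L * L * L].

Lemma of4_codewords x : x \in codewords -> exists t, of4 x = total_ext t.
Proof. by case/imsetP=> t _ ->; exists t; rewrite tup4K. Qed.

Lemma codewords_del x (y : word 3 q) :
  x \in codewords -> y \in del1 x -> of4 x = total_ext (of3 y).
Proof.
move=> /of4_codewords[t xE]; rewrite mem_del1_of xE => yt.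
by have [_ ->] := total_ext_perfect t.
Qed.

Lemma codewords_corrects1 : corrects1 codewords.
Proof.
apply/forall_inP => x xC; apply/forall_inP => x' x'C; apply/implyP => xx'.
rewrite -setI_eq0; apply/set0Pn => -[y /setIP[yx yx']].
move/eqP: xx'; apply; apply: (can_inj (@of4K q)).
by rewrite (codewords_del xC yx) (codewords_del x'C yx').
Qed.

Lemma codewords_cover : del1_code codewords = [set: word 3 q].
Proof.
apply/setP => y; rewrite [RHS]inE; apply/bigcupP.
exists (tup4 (total_ext (of3 y))); first exact: imset_f.
by rewrite mem_del1_of tup4K; case: (total_ext_perfect (of3 y)).
Qed.

(** Each letter a has one triple [aba] with b = f a. Lowering its weight by one removes exactly the
    slack q of the upper bound, and every codeword then weighs at most 4; as all triples are
    covered, this bounds the number of codewords from below. *)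
Definition reduced_weight (t : L * L * L) : nat :=
  let: (a, b, c) := t in weight t - ((a == c) && (b == f a)).

Lemma sum_reduced_weight :
  \sum_a \sum_b \sum_c reduced_weight (a, b, c) = q ^ 2 * (q + 2).
Proof.
have [fK f_neq] := f_inv.
pose r (a b c : L) : nat := (a == c) && (b == f a).
have sum_r : \sum_a \sum_b \sum_c r a b c = q.
  rewrite (eq_bigr (fun=> 1)) ?sum1_card ?card_ord // => a _.
  rewrite (bigD1 (f a)) //= (bigD1 a) //= /r !eqxx !big1 // => [b bf|c ca].
    by apply: big1 => c _; rewrite (negbTE bf) andbF.
  by rewrite eq_sym (negbTE ca).
have : \sum_a \sum_b \sum_c reduced_weight (a, b, c)
       + \sum_a \sum_b \sum_c r a b c = q * (q + 1) ^ 2.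
  rewrite -sum_weight -big_split /=; apply: eq_bigr => a _.
  rewrite -big_split /=; apply: eq_bigr => b _.
  rewrite -big_split /=; apply: eq_bigr => c _.
  by rewrite /r subnK //; case: (_ && _); case: (a == b); case: (b == c).
by rewrite sum_r; nia.
Qed.

Lemma reduced_weight_dels t :
  \sum_(u <- undup (dels (total_ext t))) reduced_weight u <= 4.
Proof.
have [fK f_neq] := f_inv.
case: (boolP (essential f t)) => [et|].
  rewrite total_ext_essential //; have [_ tu] := e_design et.
  apply: leq_trans (_ : \sum_(u <- undup (dels (e t))) 1 <= _).
    rewrite big_seq [leqRHS]big_seq; apply: leq_sum => -[[a b] c].
    rewrite mem_undup => /tu[/and3P[/negbTE ab /negbTE bc _] _] /=.
    by rewrite ab bc; case: (_ && _).
  rewrite sum1_size; apply: leq_trans (size_undup _) _.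
  by case: (e t) => [[[]]].
move=> /total_ext_not_essential[[a [_ ->]]|[a [b [ab bf -> _]]]|[a [b [bE -> _]]]].
- by decide_eqs; case: (_ == f _).
- by decide_eqs.
have ba : b != a by rewrite bE.
by decide_eqs; rewrite ?bE ?fK ?eqxx ?andbF.
Qed.

Lemma card_codewords : 4 * #|codewords| = q ^ 2 * (q + 2).
Proof.
apply/eqP; rewrite eqn_leq card_corrects1_le ?codewords_corrects1 //=.
rewrite -sum_reduced_weight -sum_words3.
have -> : \sum_(y : word 3 q) reduced_weight (of3 y)
  = \sum_(y in del1_code codewords) reduced_weight (of3 y).
  by apply: eq_bigl => y; rewrite codewords_cover inE.
rewrite sum_del1_code ?codewords_corrects1 // mulnC -sum_nat_const.
by apply: leq_sum => x /of4_codewords[t ->]; apply: reduced_weight_dels.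
Qed.

Lemma design_optimal_code :
  exists C : {set word 4 q},
    [/\ corrects1 C, perfect1 C, del1_code C = [set: word 3 q], #|C| = N1 3 q
      & N1 3 q = q ^ 2 * (q + 2) %/ 4].
Proof.
have cardC : #|codewords| = q ^ 2 * (q + 2) %/ 4 by rewrite -card_codewords mulKn.
have N1E : N1 3 q = #|codewords|.
  apply/eqP; rewrite eqn_leq; apply/andP; split; last first.
    exact: (bigmax_sup codewords codewords_corrects1).
  apply/bigmax_leqP => C hC.
  by rewrite -(leq_pmul2l (isT : 0 < 4)) card_codewords card_corrects1_le.
have coverT : del1_code [set: word 4 q] = [set: word 3 q].
  apply/eqP; rewrite eqEsubset subsetT -codewords_cover; apply/subsetP => y.
  by case/bigcupP => x xC yx; apply/bigcupP; exists x; rewrite ?in_setT.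
exists codewords; rewrite /perfect1 N1E cardC coverT codewords_cover eqxx.
by rewrite codewords_corrects1.
Qed.
End Assembly.

(** * Transport of designs and two small tables *)

Section Transport.
Variables L L' : eqType.

Lemma dels_map4 (i : L -> L') w : dels (map4 i w) = map (map3 i) (dels w).
Proof. by case: w => [[[]]]. Qed.

Lemma map3_comp (T : Type) (i : L -> L') (j : T -> L) t :
  map3 i (map3 j t) = map3 (i \o j) t.
Proof. by case: t => [[]]. Qed.

Lemma map4_comp (T : Type) (i : L -> L') (j : T -> L) w :
  map4 i (map4 j w) = map4 (i \o j) w.
Proof. by case: w => [[[]]]. Qed.

Lemma eq_map4 (T U : Type) (i j : T -> U) w : i =1 j -> map4 i w = map4 j w.
Proof. by move=> ij; case: w => [[[a b] c] d] /=; rewrite !ij. Qed.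

Lemma essential_map3 (f : L -> L) (f' : L' -> L') (i : L -> L') t :
  injective i -> (forall x, f' (i x) = i (f x)) ->
  essential f' (map3 i t) = essential f t.
Proof.
by move=> inj_i fi; case: t => [[a b] c] /=; rewrite fi !(inj_eq inj_i).
Qed.

Definition word_of (f : L -> L) (e : L * L * L -> L * L * L * L) (w : L * L * L * L) :=
  forall u, u \in dels w -> essential f u /\ e u = w.

Lemma design_of_words f e :
  (forall t, essential f t -> exists2 w, t \in dels w & word_of f e w) -> design f e.
Proof.
move=> H t et; have [w tw Hw] := H t et.
by have [_ ->] := Hw t tw.
Qed.

End Transport.

(** A design restricts to the image of i as soon as the covering words have all their letters there.
    This serves for renamings, for keeping two of three parts, and for tables over [nat]. *)
Lemma design_pullback (L L' : eqType) (f : L -> L) (f' : L' -> L') e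
    (i : L' -> L) (r : L -> L') :
  cancel i r -> (forall x, f (i x) = i (f' x)) ->
  (forall t, essential f' t -> exists2 w, map3 i t \in dels (map4 i w) & word_of f e (map4 i w)) ->
  design f' (fun t => map4 r (e (map3 i t))).
Proof.
move=> ik fi H; apply: design_of_words => t et.
have inj_i := can_inj ik.
have inj3 : injective (map3 i).
  by move=> [[a b] c] [[a' b'] c'] [] /inj_i-> /inj_i-> /inj_i->.
have [w tw Hw] := H t et; exists w.
  by rewrite dels_map4 (mem_map inj3) in tw.
move=> u uw; have [|eu ->] := Hw (map3 i u).
  by rewrite dels_map4 map_f.
split; first by rewrite -(essential_map3 u inj_i fi).
by rewrite map4_comp; case: w {tw Hw uw} => [[[a b] c] d] /=; rewrite !ik.
Qed.

Section Lookup.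
Variables (L : eqType) (x0 : L) (ws : seq (L * L * L * L)).
Definition lookup (t : L * L * L) : L * L * L * L :=
  nth (x0, x0, x0, x0) ws (find (fun w => t \in dels w) ws).
End Lookup.

Lemma check_triples (L : eqType) (xs : seq L) (P : pred (L * L * L)) e :
  (forall x, x \in xs) ->
  all (fun t => P t ==> ((t \in dels (e t)) &&
                         all (fun u => P u && (e u == e t)) (dels (e t))))
      [seq (ab, c) | ab <- [seq (a, b) | a <- xs, b <- xs], c <- xs] ->
  forall t, P t -> t \in dels (e t) /\ forall u, u \in dels (e t) -> P u /\ e u = e t.
Proof.
move=> xsT /allP H [[a b] c] Pt.
have /H : (a, b, c) \in [seq (ab, c) | ab <- [seq (a, b) | a <- xs, b <- xs], c <- xs].
  by rewrite !allpairs_f.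
rewrite Pt => /andP[-> /allP Hu]; split=> // u /Hu/andP[-> /eqP->].
by [].
Qed.

Notation part := (option bool).

(** The last branch serves [Some true] and [Some false]; on equal parts its value is arbitrary. *)
Definition third (i j : part) : part :=
  match i, j with
  | None, Some true | Some true, None => Some false
  | None, Some false | Some false, None => Some true
  | _, _ => None
  end.

(* Orientation of the cyclic order None -> Some true -> Some false -> None. *)
Definition ccw (i j : part) : bool :=
  match i, j with
  | None, Some true | Some true, Some false | Some false, None => true
  | _, _ => false
  end.

Lemma third_neq i j : i != j -> (third i j != i) * (third i j != j).
Proof. by case: i j => [[]|] [[]|]. Qed.

Lemma thirdE i j k : i != j -> i != k -> j != k -> third i j = k.
Proof. by case: i j k => [[]|] [[]|] [[]|]. Qed.

Lemma ccw_rot i j k : i != j -> i != k -> j != k -> ccw j k = ccw i j.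
Proof. by case: i j k => [[]|] [[]|] [[]|]. Qed.

Lemma ccw_swap i j k : i != j -> i != k -> j != k -> ccw i k = ~~ ccw i j.
Proof. by case: i j k => [[]|] [[]|] [[]|]. Qed.

(* A perfect single-deletion code in the symmetric group on the four labels. *)
Definition perm_words : seq (option part * option part * option part * option part) :=
  let n (k : nat) := nth None [:: Some None; Some (Some true); Some (Some false); None] k in
  [seq map4 n w | w <- [:: (0, 1, 2, 3); (1, 0, 3, 2); (2, 0, 3, 1);
                           (2, 1, 3, 0); (3, 0, 2, 1); (3, 1, 2, 0)]].

Definition distinct3 (L : eqType) (t : L * L * L) : bool :=
  let: (a, b, c) := t in uniq [:: a; b; c].

Definition perm_ext := lookup None perm_words.

Lemma perm_extP t : distinct3 t ->
  t \in dels (perm_ext t) /\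
  forall u, u \in dels (perm_ext t) -> distinct3 u /\ perm_ext u = perm_ext t.
Proof.
move: t; apply: (@check_triples _ [:: None; Some None; Some (Some true); Some (Some false)]).
  by case=> [[[]|]|].
by vm_compute.
Qed.

(* The orbits under Z/6 of six words found by computer search. *)
Definition cube_words : seq ((part * bool) * (part * bool) * (part * bool) * (part * bool)) :=
  let n (k : nat) := (nth None [:: None; Some true; Some false] (k %% 3), 3 <= k) in
  [seq map4 (fun x => n ((x + s) %% 6)) w |
     w <- [:: (0, 4, 1, 0); (0, 2, 5, 0); (0, 1, 4, 2); (0, 5, 2, 4); (0, 2, 1, 3);
              (0, 4, 5, 3)], s <- iota 0 6].

Definition cube_ext := lookup (None, false) cube_words.

(** In the numbering of [cube_words] by Z/6 this is addition of 3, so it commutes with the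
    shifts. *)
Definition flip (l : part * bool) : part * bool := (l.1, ~~ l.2).

Lemma cube_ext_design : design flip cube_ext.
Proof.
apply: (@check_triples _ [seq (i, b) | i <- [:: None; Some true; Some false],
                                       b <- [:: false; true]]).
  by case=> [[[]|] []].
by vm_compute.
Qed.

Lemma flip_fpf : fpf_involution flip.
Proof. by split=> -[[[]|] []]. Qed.

(** * Composition of designs *)

(* The new alphabet consists of three copies (parts) of G and of the stem S. Triples inside
   a part and the stem are extended by the given design [e0]; the others as follows.
   - xx'y and yxx', with x, x' in one part and y in another: by the kind [ck] of the factor
     containing the pair xx' and of its orientation. A plain factor gives the words xx'yy'
     with yy' in the same oriented factor; a factor with shift d gives words y,x,x',y+d.
   - xyx', with x, x' in one part and y in another: by the kind [dk] of the shift x' - x,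
     which is either the shift of an oriented factor, or a difference realized by [mu].
   - xyz in three parts: by the kind [tk] of x + y + z. The sum of a stem letter gives a
     permutation of x, y, z and this letter; otherwise the words are x,y,z,x+d where d is
     the difference between [mu] of the sum and the sum.
   Cubes are made of three pairs {x, x+h}, one in each part, with sum 0 or h; all the
   triples inside a cube are extended by the design on six letters. *)
Inductive color_kind (G : Type) := ColorPlain | ColorShift of G | ColorCube.
Inductive shift_kind (G C : Type) := ShiftColor of C & bool | ShiftPair of bool & G | ShiftCube.
Inductive sum_kind (S : Type) := SumStem of S | SumPair | SumCube.
Arguments ColorPlain {G}. Arguments ColorCube {G}. Arguments ShiftCube {G C}.
Arguments ShiftPair {G C}. Arguments ShiftColor {G C}.
Arguments SumPair {S}. Arguments SumCube {S}.

(** P carries a subdesign. Three copies of the design can then share P as their stem, because they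
    extend its triples in the same way. *)
Definition closed_in (L : eqType) (P : pred L) (f : L -> L) e :=
  (forall x, P x -> P (f x)) /\
  forall a b c, essential f (a, b, c) -> P a -> P b -> P c ->
    let: (x, y, z, w) := e (a, b, c) in [&& P x, P y, P z & P w].

Section Composition.
#[local] Opaque perm_ext cube_ext.
Local Open Scope ring_scope.
Variables (G : comNzRingType) (S C : eqType).
Variables (h : G) (fS : S -> S).
Variable e0 : (G + S) * (G + S) * (G + S) -> (G + S) * (G + S) * (G + S) * (G + S).
Variables (col : G -> G -> C) (mate : C -> G -> G) (lt : rel G).
Variables (ck : C -> bool -> color_kind G) (dk : G -> shift_kind G C) (tk : G -> sum_kind S).
Variables (stem_sum : S -> G) (mu : bool -> G -> G) (src : bool -> G -> bool).
Variables (bit : G -> bool) (cubes : bool).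

Definition small_f (l : G + S) : G + S :=
  match l with inl x => inl (x + h) | inr s => inr (fS s) end.

Notation letter := ((part * G) + S)%type.

Definition big_f (l : letter) : letter :=
  match l with inl (i, x) => inl (i, x + h) | inr s => inr (fS s) end.

Definition embed (i : part) (l : G + S) : letter :=
  match l with inl x => inl (i, x) | inr s => inr s end.
Definition drop_part (l : letter) : G + S :=
  match l with inl (i, x) => inl x | inr s => inr s end.
Definition inside (i : part) (t : letter * letter * letter) :=
  map4 (embed i) (e0 (map3 drop_part t)).

(** [lt] splits a factor into two oriented ones. Every letter lies in exactly one ordered pair of
    each, which makes the fourth letter of a word unique. *)
Definition orient (o : bool) (c : C) (y : G) : G * G :=
  if lt y (mate c y) == o then (y, mate c y) else (mate c y, y).

Definition label (l : letter) : option part :=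
  match l with inl (i, _) => Some i | inr _ => None end.
Definition stem_letter (s : S) (x : part -> G) (l : option part) : letter :=
  match l with Some k => inl (k, x k) | None => inr s end.
Definition complete (i j : part) (x y z : G) (k : part) : G :=
  if k == i then x else if k == j then y else z.
Definition stem_word (s : S) (i j : part) (x y : G) (t : letter * letter * letter) :=
  map4 (stem_letter s (complete i j x y (stem_sum s - x - y))) (perm_ext (map3 label t)).

Definition canon (x : G) : G := if bit x then x + h else x.
Definition cube_label (l : letter) : part * bool :=
  match l with inl (i, x) => (i, bit x) | inr _ => (None, false) end.
Definition cube_letter (b : part -> G) (l : part * bool) : letter :=
  inl (l.1, if l.2 then b l.1 + h else b l.1).
Definition cube_word (i j : part) (x y : G) (t : letter * letter * letter) :=
  map4 (cube_letter (complete i j (canon x) (canon y) (canon (- (x + y)))))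
       (cube_ext (map3 cube_label t)).

Definition big_ext (t : letter * letter * letter) : letter * letter * letter * letter :=
  let: (l1, l2, l3) := t in
  match l1, l2, l3 with
  | inl (i, x), inl (j, y), inl (k, z) =>
    if i == j then
      if j == k then inside i t else
      match ck (col x y) (lt x y) with
      | ColorPlain => let: (u, v) := orient (lt x y) (col x y) z in
                      (l1, l2, inl (k, u), inl (k, v))
      | ColorShift d => (inl (k, z - d), l1, l2, l3)
      | ColorCube => cube_word i k x z t
      end
    else if j == k then
      match ck (col y z) (lt y z) with
      | ColorPlain => let: (u, v) := orient (lt y z) (col y z) x in
                      (inl (i, u), inl (i, v), l2, l3)
      | ColorShift d => (l1, l2, l3, inl (i, x + d))
      | ColorCube => cube_word i j x y t
      end
    else if i == k then
      match dk (z - x) with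
      | ShiftColor c o => let: (u, v) := orient o c y in
                          (l1, inl (j, u), inl (j, v), l3)
      | ShiftPair s a => let l := inl (third i j, a - x - y) in
                         if ccw i j == s then (l1, l2, l, l3) else (l1, l, l2, l3)
      | ShiftCube => cube_word i j x y t
      end
    else
      let a := x + y + z in
      match tk a with
      | SumStem s => stem_word s i j x y t
      | SumPair => let d := mu (ccw i j) a - a in
                   if src (ccw i j) a then (l1, l2, l3, inl (i, x + d))
                   else (inl (k, z + d), l1, l2, l3)
      | SumCube => cube_word i j x y t
      end
  | inl (i, x), inl (j, y), inr s | inl (i, x), inr s, inl (j, y)
  | inr s, inl (i, x), inl (j, y) =>
    if i == j then inside i t else stem_word s i j x y t
  | inl (i, _), _, _ | _, inl (i, _), _ | _, _, inl (i, _) => inside i t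
  | _, _, _ => inside None t
  end.

Notation good := (word_of big_f big_ext).

Lemma embed_inj i : injective (embed i).
Proof. by move=> [x|s] [y|s'] //= []->. Qed.

Lemma big_f_embed i l : big_f (embed i l) = embed i (small_f l).
Proof. by case: l. Qed.

Lemma embedK i : cancel (embed i) drop_part.
Proof. by case. Qed.

Hypothesis e0_design : design small_f e0.
Hypothesis stem_closed : forall s1 s2 s3, essential fS (s1, s2, s3) ->
  exists w, e0 (inr s1, inr s2, inr s3) = map4 inr w.

(** Stem triples belong to all three copies but are extended through part [None]. The results agree
    because their words consist of stem letters, on which all [embed i] coincide. *)
Lemma big_ext_embed i t : essential small_f t ->
  big_ext (map3 (embed i) t) = map4 (embed i) (e0 t).
Proof.
have ins t' : inside i (map3 (embed i) t') = map4 (embed i) (e0 t').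
  by rewrite /inside map3_comp; case: t' => [[a b] c] /=; rewrite !embedK.
case: t => [[[x|s1] [y|s2]] [z|s3]]; rewrite -?ins //= ?eqxx // => et.
have [|w wE] := stem_closed (_ : essential fS (s1, s2, s3)); first by [].
by rewrite /inside /= wE !map4_comp; apply: eq_map4.
Qed.

Lemma embed_closed (Q : pred (G + S)) : closed_in Q small_f e0 ->
  closed_in (fun l => (l == embed None (drop_part l)) && Q (drop_part l)) big_f big_ext.
Proof.
move=> [Qf Qe]; split=> [l|a b c et] /andP[/eqP aE Qa].
  by rewrite aE big_f_embed embedK eqxx Qf.
move=> /andP[/eqP bE Qb] /andP[/eqP cE Qc].
have tE : (a, b, c) = map3 (embed None) (drop_part a, drop_part b, drop_part c).
  by rewrite /= -aE -bE -cE.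
have et0 : essential small_f (drop_part a, drop_part b, drop_part c).
  by rewrite tE (essential_map3 _ (@embed_inj None) (big_f_embed None)) in et.
have := Qe _ _ _ et0 Qa Qb Qc; rewrite tE big_ext_embed //.
by case: (e0 _) => [[[x y] z] w] /and4P[Qx Qy Qz Qw] /=; rewrite !embedK !eqxx Qx Qy Qz.
Qed.

Lemma inside_good i t : essential small_f t -> good (map4 (embed i) (e0 t)).
Proof.
move=> et u; rewrite dels_map4 => /mapP[v vt ->].
have [_ H] := e0_design et; have [ev <-] := H v vt.
rewrite (essential_map3 _ (@embed_inj i) (big_f_embed i)); split=> //.
exact: big_ext_embed.
Qed.

(** * Words built from the one-factorization *)

Hypothesis lt_asym : forall x y, x != y -> lt y x = ~~ lt x y.
Hypothesis colC : forall x y, col y x = col x y.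
Hypothesis mate_col : forall x y, x != y -> mate (col x y) x = y.
Hypothesis mate_neq : forall c x, mate c x != x.
Hypothesis col_mate : forall c x, col x (mate c x) = c.

Lemma orientl y z : y != z -> orient (lt y z) (col y z) y = (y, z).
Proof. by move=> yz; rewrite /orient mate_col // eqxx. Qed.

Lemma orientr y z : y != z -> orient (lt y z) (col y z) z = (y, z).
Proof.
move=> yz; rewrite /orient -colC mate_col 1?eq_sym // [lt y z]lt_asym 1?eq_sym //.
by case: (lt z y).
Qed.

Lemma orientP o c y : exists u v,
  [/\ orient o c y = (u, v), u != v, col u v = c, lt u v = o & (y = u) \/ (y = v)].
Proof.
rewrite /orient; case: eqP => [<-|/eqP H].
  by exists y, (mate c y); rewrite eq_sym mate_neq col_mate; split=> //; left.
exists (mate c y), y; rewrite mate_neq colC col_mate; split=> //; last by right.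
by rewrite lt_asym 1?eq_sym ?mate_neq //; move: H; case: (lt _ _); case: (o).
Qed.

(** Deleting a letter leaves one pair intact and one letter of the other pair; the common oriented
    factor recovers the missing letter. *)
Lemma plain_good i j x x' y y' : i != j -> x != x' -> y != y' ->
  col y y' = col x x' -> lt y y' = lt x x' -> ck (col x x') (lt x x') = ColorPlain ->
  good (inl (i, x), inl (i, x'), inl (j, y), inl (j, y')).
Proof.
move=> ij xx yy cE oE pl.
have ji : (j == i) = false by rewrite eq_sym (negbTE ij).
have ol := orientl yy; have or := orientr yy.
rewrite cE oE in ol or.
have hx (a b : G) : ((inl (i, a) : letter) == inl (j, b)) = false.
  by rewrite -[LHS]/((i, a) == (j, b)) xpair_eqE (negbTE ij).
have hxi k (a b : G) : ((inl (k, a) : letter) == inl (k, b)) = (a == b).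
  by rewrite -[LHS]/((k, a) == (k, b)) xpair_eqE eqxx.
move=> u; rewrite !inE; do 3 ?case/orP; move/eqP=> {u}->.
- by rewrite /= !eqxx !hx !hxi yy (negbTE ij) cE oE pl orientr.
- by rewrite /= !eqxx !hx !hxi yy (negbTE ij) cE oE pl orientl.
- by rewrite /= !eqxx !hx !hxi xx (negbTE ij) pl or.
- by rewrite /= !eqxx !hx !hxi xx (negbTE ij) pl ol.
Qed.

Hypothesis ck_shift : forall c o d, ck c o = ColorShift d <-> dk d = ShiftColor c o.

Lemma letter_neqP i j (x y : G) : i != j -> ((inl (i, x) : letter) == inl (j, y)) = false.
Proof. by move=> ij; rewrite -[LHS]/((i, x) == (j, y)) xpair_eqE (negbTE ij). Qed.

Lemma letter_eqP i (x y : G) : ((inl (i, x) : letter) == inl (i, y)) = (x == y).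
Proof. by rewrite -[LHS]/((i, x) == (i, y)) xpair_eqE eqxx. Qed.

(** The two triples containing y and y' recover the missing outer letter from the shift d. The other
    two show the difference d, hence by [ck_shift] the oriented factor, hence the pair from either
    of its letters. *)
Lemma shift_good i j x d y y' : i != j -> y != y' ->
  ck (col y y') (lt y y') = ColorShift d ->
  good (inl (i, x), inl (j, y), inl (j, y'), inl (i, x + d)).
Proof.
move=> ij yy cE; have dE := (ck_shift _ _ _).1 cE.
have ji : j != i by rewrite eq_sym.
have xd : x + d - x = d by ring.
move=> u; rewrite !inE; do 3 ?case/orP; move/eqP=> {u}->;
  rewrite /= ?eqxx ?(letter_neqP _ _ ij) ?(letter_neqP _ _ ji) ?letter_eqP ?yy
    ?(negbTE ij) ?(negbTE ji) ?cE ?xd ?dE ?orientl ?orientr ?orbT //; split=> //.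
by congr (inl (_, _), _, _, _); ring.
Qed.

(** * Words through a stem letter *)

Hypothesis tk_stem : forall a s, tk a = SumStem s <-> stem_sum s = a.

(** The stem letter and two of the letters of x determine the third letter through the sum, and the
    three letters of x determine s; so every triple recovers all four letters. *)
Lemma stem_good s x w : x None + x (Some true) + x (Some false) = stem_sum s ->
  (forall t, t \in dels w -> distinct3 t /\ perm_ext t = w) ->
  good (map4 (stem_letter s x) w).
Proof.
move=> xs Hw u; rewrite dels_map4 => /mapP[t /Hw[dt <-] ->] {u Hw w}.
have x0 : stem_sum s - x None - x (Some true) = x (Some false) by rewrite -xs; ring.
have x1 : stem_sum s - x None - x (Some false) = x (Some true) by rewrite -xs; ring.
have x2 : stem_sum s - x (Some true) - x (Some false) = x None by rewrite -xs; ring.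
have ts a : a = stem_sum s -> tk a = SumStem s by move=> ->; apply/tk_stem.
have lK : map3 label (map3 (stem_letter s x) t) = t.
  by case: t {dt} => [[[i|] [j|]] [k|]].
have compl i j : i != j ->
    stem_letter s (complete i j (x i) (x j) (stem_sum s - x i - x j)) =1 stem_letter s x.
  by move=> ij [k|//]; rewrite /= /complete; congr (inl (_, _));
     case: i j k ij => [[]|] [[]|] [[]|] //= _; rewrite -xs; ring.
have sw i j : i != j ->
    stem_word s i j (x i) (x j) (map3 (stem_letter s x) t)
    = map4 (stem_letter s x) (perm_ext t).
  by move=> ij; rewrite /stem_word lK; apply: eq_map4; apply: compl.
move: dt sw {lK}; case: t => [[[i|] [j|]] [k|]] /=; rewrite ?inE //= => dt sw.
- have ij : i != j by apply: contraL dt => /eqP->; rewrite eqxx ?orbT ?andbF.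
  have ik : i != k by apply: contraL dt => /eqP->; rewrite eqxx ?orbT ?andbF.
  have jk : j != k by apply: contraL dt => /eqP->; rewrite eqxx ?orbT ?andbF.
  have ji : j != i by rewrite eq_sym.
  rewrite !letter_neqP //= (negbTE ij) (negbTE ik) (negbTE jk); split=> //.
  rewrite ts ?sw //.
  by case: i j k ij ik jk {ji dt sw} => [[]|] [[]|] [[]|] //= _ _ _; rewrite -xs; ring.
- have ij : i != j by apply: contraL dt => /eqP->; rewrite eqxx ?orbT ?andbF.
  by rewrite letter_neqP // (negbTE ij) sw.
- have ik : i != k by apply: contraL dt => /eqP->; rewrite eqxx ?orbT ?andbF.
  by rewrite letter_neqP // (negbTE ik) sw.
- have jk : j != k by apply: contraL dt => /eqP->; rewrite eqxx ?orbT ?andbF.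
  by rewrite letter_neqP // (negbTE jk) sw.
Qed.

(** * Words from pairs of sums *)

Hypothesis mu_pair : forall s a, tk a = SumPair -> tk (mu s a) = SumPair.
Hypothesis mu_inv : forall s a, tk a = SumPair -> mu s (mu s a) = a.
Hypothesis src_mu : forall s a, tk a = SumPair -> src s (mu s a) = ~~ src s a.
Hypothesis dk_src : forall s a, tk a = SumPair -> src s a ->
  dk (mu s a - a) = ShiftPair s a.
Hypothesis dk_pair : forall d s a, dk d = ShiftPair s a ->
  [/\ tk a = SumPair, src s a & mu s a = a + d].

(** With d = [mu s a - a], the triple x, y, z has the source sum a, and y, z, x + d has the sum
    [mu s a] and the same cyclic order. The remaining two have difference d, and the cyclic order
    tells whether their middle letter is the second or the third of the word. *)
Lemma pair_good i j k x y z (s := ccw i j) (a := x + y + z) :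
  i != j -> i != k -> j != k -> tk a = SumPair -> src s a ->
  good (inl (i, x), inl (j, y), inl (k, z), inl (i, x + (mu s a - a))).
Proof.
move=> ij ik jk ta sa.
have ji : j != i by rewrite eq_sym.
have ki : k != i by rewrite eq_sym.
have kj : k != j by rewrite eq_sym.
have sum' : y + z + (x + (mu s a - a)) = mu s a by rewrite /a; ring.
have dif : x + (mu s a - a) - x = mu s a - a by ring.
have y' : a - x - z = y by rewrite /a; ring.
have z' : a - x - y = z by rewrite /a; ring.
move=> u; rewrite !inE; do 3 ?case/orP; move/eqP=> {u}->;
  rewrite /= ?eqxx ?(letter_neqP _ _ ij) ?(letter_neqP _ _ ik) ?(letter_neqP _ _ jk)
    ?(letter_neqP _ _ ji) ?(letter_neqP _ _ ki) ?(letter_neqP _ _ kj) ?orbT //=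
    ?(negbTE ij) ?(negbTE ik) ?(negbTE jk)
    ?(negbTE ji) ?(negbTE ki) ?(negbTE kj) ?dif ?dk_src //.
- rewrite sum' mu_pair // (ccw_rot ij) // -/s src_mu // sa mu_inv //.
  by split=> //=; congr (inl (_, _), _, _, _); ring.
- by rewrite (ccw_swap ij) // -/s (thirdE ik ij) // y'; case: (s).
- by rewrite -/s eqxx (thirdE ij ik) // z'.
- by rewrite -/a -/s ta sa.
Qed.

(** * Cubes *)

Definition two (t : G) := t = 0 \/ t = h.

Hypothesis hh : h + h = 0.
Hypothesis bit_h : forall x, bit (x + h) = ~~ bit x.
Hypothesis ck_cube : forall c o, ck c o = ColorCube -> cubes /\ forall x, mate c x = x + h.
Hypothesis cube_ck : cubes -> forall x o, ck (col x (x + h)) o = ColorCube.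
Hypothesis dk_cube : forall d, dk d = ShiftCube -> cubes /\ two d.
Hypothesis cube_dk : cubes -> dk 0 = ShiftCube /\ dk h = ShiftCube.
Hypothesis tk_cube : forall a, tk a = SumCube -> cubes /\ two a.
Hypothesis cube_tk : cubes -> tk 0 = SumCube /\ tk h = SumCube.

Lemma h_neq (x : G) : x + h != x.
Proof. by apply/eqP => E; have := bit_h x; rewrite E; case: (bit x). Qed.

Lemma canon_h x : canon (x + h) = canon x.
Proof. by rewrite /canon bit_h; case: (bit x) => //=; rewrite -addrA hh addr0. Qed.

Lemma bit_canon x : bit (canon x) = false.
Proof. by rewrite /canon; case: ifP => // xb; rewrite bit_h xb. Qed.

Lemma canonK x : (if bit x then canon x + h else canon x) = x.
Proof. by rewrite /canon; case: (bit x) => //; rewrite -addrA hh addr0. Qed.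

Lemma twoD a b : two a -> two b -> two (a + b).
Proof.
by case=> -> [] ->; rewrite ?addr0 ?add0r ?hh; [left|right|right|left].
Qed.

Lemma twoN a : two a -> two (- a).
Proof.
case=> ->; first by left; rewrite oppr0.
by right; apply: (addrI h); rewrite hh subrr.
Qed.

Lemma canon_two x a : two a -> canon (x + a) = canon x.
Proof. by case=> ->; rewrite ?addr0 ?canon_h. Qed.

(** Since the sum of the bases is 0 or h, the pairs in two parts determine the third, so a triple
    meeting two parts recovers its cube. Three letters in one part would come from a single pair {x,
    x + h}, and no such triple is essential. *)
Lemma cube_good b w : cubes -> (forall i, bit (b i) = false) ->
  two (b None + b (Some true) + b (Some false)) ->
  (forall t, t \in dels w -> essential flip t /\ cube_ext t = w) ->
  good (map4 (cube_letter b) w).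
Proof.
move=> cu bb sb Hw u; rewrite dels_map4 => /mapP[t /Hw[et <-] ->] {u Hw w}.
have inj : injective (cube_letter b).
  move=> [i x] [j y] [<-] /=.
  by case: x y => -[] // /eqP; rewrite 1?[b i == _]eq_sym (negbTE (h_neq _)).
have fl l : big_f (cube_letter b l) = cube_letter b (flip l).
  by case: l => i [] //=; rewrite /cube_letter /= -addrA hh addr0.
split; first by rewrite (essential_map3 _ inj fl).
pose v i e := if e then b i + h else b i.
have bv i e : bit (v i e) = e by rewrite /v; case: e; rewrite ?bit_h bb.
have cv i e : canon (v i e) = b i.
  by rewrite /v; case: e; rewrite ?canon_h /canon bb.
have vb i e : two (v i e - b i).
  by rewrite /v; case: e; [right; ring|left; rewrite subrr].
have cl i e : cube_letter b (i, e) = inl (i, v i e) by [].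
have lK : map3 cube_label (map3 (cube_letter b) t) = t.
  by case: t {et} => [[[i ei] [j ej]] [k ek]]; rewrite /= !bv.
have sum3 i j k : i != j -> i != k -> j != k -> two (b i + b j + b k).
  move=> ij ik jk; suff -> : b i + b j + b k = b None + b (Some true) + b (Some false) by [].
  by case: i j k ij ik jk => [[]|] [[]|] [[]|] //= _ _ _; ring.
have compl i j ei ej : i != j ->
    complete i j (canon (v i ei)) (canon (v j ej)) (canon (- (v i ei + v j ej))) =1 b.
  move=> ij k; rewrite /complete !cv.
  case: (eqVneq k i) => [->//|ki]; case: (eqVneq k j) => [->//|kj].
  have -> : - (v i ei + v j ej) =
      b k + - ((b i + b j + b k) + (v i ei - b i) + (v j ej - b j)) by ring.
  rewrite canon_two /canon ?bb //; apply: twoN.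
  by apply: twoD (vb _ _); apply: twoD (vb _ _); apply: sum3; rewrite // eq_sym.
have cw i j ei ej : i != j ->
    cube_word i j (v i ei) (v j ej) (map3 (cube_letter b) t)
    = map4 (cube_letter b) (cube_ext t).
  move=> ij; rewrite /cube_word lK; apply: eq_map4 => -[k e].
  by rewrite /cube_letter /= compl.
have v2 i e e' : e != e' -> v i e' = v i e + h.
  by rewrite /v; case: e e' => -[] // _; rewrite -addrA hh addr0.
move: et cw {lK}; case: t => [[[i ei] [j ej]] [k ek]].
rewrite [map3 _ _]/= !cl => et cw; rewrite /big_ext.
case: (eqVneq i j) et => [ij|ij] et.
  subst j.
  have eij : ei != ej.
    by apply: contraL et => /eqP->; rewrite /= eqxx.
  have [ik|ik] := eqVneq i k.
    subst k; move: et; rewrite /= /flip /= !xpair_eqE !eqxx /=.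
    by move: eij; case: (ei); case: (ej); case: (ek).
  have -> : ck (col (v i ei) (v i ej)) (lt (v i ei) (v i ej)) = ColorCube.
    by rewrite (v2 _ _ _ eij) cube_ck.
  exact: cw.
have [jk|jk] := eqVneq j k.
  subst k; have ejk : ej != ek.
    by apply: contraL et => /eqP->; rewrite /= eqxx andbF.
  have -> : ck (col (v j ej) (v j ek)) (lt (v j ej) (v j ek)) = ColorCube.
    by rewrite (v2 _ _ _ ejk) cube_ck.
  exact: cw.
have [ik|ik] := eqVneq i k.
  subst k; have [d0 dh] := cube_dk cu.
  have -> : dk (v i ek - v i ei) = ShiftCube.
    case: (eqVneq ei ek) => [->|eik]; first by rewrite subrr.
    by rewrite (v2 _ _ _ eik) addrAC subrr add0r.
  by rewrite cw.
have [t0 th] := cube_tk cu.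
have -> : tk (v i ei + v j ej + v k ek) = SumCube.
  suff [->//|->//] : two (v i ei + v j ej + v k ek).
  have -> : v i ei + v j ej + v k ek =
      b i + b j + b k + (v i ei - b i) + (v j ej - b j) + (v k ek - b k) by ring.
  by do 3![apply: twoD (vb _ _)]; apply: sum3.
by rewrite cw.
Qed.

Definition cube_base i j x y := complete i j (canon x) (canon y) (canon (- (x + y))).

Lemma two_canon a : two (canon a - a).
Proof. by rewrite /canon; case: (bit a); [right; ring|left; rewrite subrr]. Qed.

Lemma cover_cube i j x y t : cubes -> i != j ->
  map3 (cube_letter (cube_base i j x y)) (map3 cube_label t) = t ->
  essential flip (map3 cube_label t) -> exists2 w, t \in dels w & good w.
Proof.
move=> cu ij tE et; set b := cube_base _ _ _ _ in tE.
have [tw Hw] := cube_ext_design et.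
exists (map4 (cube_letter b) (cube_ext (map3 cube_label t))).
  by rewrite -{1}tE dels_map4 map_f.
apply: cube_good => //.
  by move=> k; rewrite /b /cube_base /complete; case: ifP => _; [|case: ifP => _];
     rewrite bit_canon.
have -> : b None + b (Some true) + b (Some false) =
    canon x + canon y + canon (- (x + y)).
  by rewrite /b /cube_base /complete; case: i j ij {b tE} => [[]|] [[]|] //= _; ring.
have -> : canon x + canon y + canon (- (x + y)) =
   (canon x - x) + (canon y - y) + (canon (- (x + y)) - - (x + y)) by ring.
by apply: twoD (two_canon _); apply: twoD; apply: two_canon.
Qed.

Lemma cube_letterK b i x : b i = canon x -> cube_letter b (i, bit x) = inl (i, x).
Proof. by move=> bE; rewrite /cube_letter /= bE canonK. Qed.

Lemma cube_base1 i j x y : cube_base i j x y i = canon x.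
Proof. by rewrite /cube_base /complete eqxx. Qed.

Lemma cube_base2 i j x y : i != j -> cube_base i j x y j = canon y.
Proof. by move=> ij; rewrite /cube_base /complete eqxx eq_sym (negbTE ij). Qed.

Lemma cube_base3 i j k x y : i != k -> j != k -> cube_base i j x y k = canon (- (x + y)).
Proof.
by move=> ik jk; rewrite /cube_base /complete ![k == _]eq_sym (negbTE ik) (negbTE jk).
Qed.

(** * Every essential triple lies in a good word *)

Notation covered t := (exists2 w, t \in dels w & good w).

Lemma cover_iij i k x y z : i != k -> x != y ->
  covered (inl (i, x), inl (i, y), inl (k, z)).
Proof.
move=> ik xy; case E: (ck (col x y) (lt x y)) => [|d|].
- have [u [v [_ uv cE oE zuv]]] := orientP (lt x y) (col x y) z.
  exists (inl (i, x), inl (i, y), inl (k, u), inl (k, v)); last exact: plain_good.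
  by case: zuv => ->; rewrite !inE eqxx ?orbT.
- exists (inl (k, z - d), inl (i, x), inl (i, y), inl (k, z - d + d)).
    by rewrite subrK !inE eqxx.
  by apply: shift_good => //; rewrite eq_sym.
have [cu mE] := ck_cube E; have yE : y = x + h by rewrite -mE mate_col.
apply: (@cover_cube i k x z) => //.
  rewrite /= !cube_letterK ?cube_base2 ?cube_base1 //.
  by rewrite yE canon_h.
by rewrite yE /= bit_h !xpair_eqE (negbTE ik) eqxx /=; case: (bit x).
Qed.

Lemma cover_ijj i j x y z : i != j -> y != z ->
  covered (inl (i, x), inl (j, y), inl (j, z)).
Proof.
move=> ij yz; case E: (ck (col y z) (lt y z)) => [|d|].
- have [u [v [_ uv cE oE xuv]]] := orientP (lt y z) (col y z) x.
  exists (inl (i, u), inl (i, v), inl (j, y), inl (j, z)).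
    by case: xuv => ->; rewrite !inE eqxx ?orbT.
  by apply: plain_good; rewrite ?cE ?oE.
- exists (inl (i, x), inl (j, y), inl (j, z), inl (i, x + d)).
    by rewrite !inE eqxx ?orbT.
  exact: shift_good.
have [cu mE] := ck_cube E; have zE : z = y + h by rewrite -mE mate_col.
apply: (@cover_cube i j x y) => //.
  rewrite /= !cube_letterK ?cube_base2 ?cube_base1 //.
  by rewrite zE canon_h.
by rewrite zE /= bit_h !xpair_eqE (negbTE ij) eqxx /=; case: (bit y).
Qed.

Lemma cover_iji i j x y z : i != j -> covered (inl (i, x), inl (j, y), inl (i, z)).
Proof.
move=> ij; case E: (dk (z - x)) => [c o|s a|].
- have [u [v [_ uv cE oE yuv]]] := orientP o c y.
  exists (inl (i, x), inl (j, u), inl (j, v), inl (i, x + (z - x))).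
    by rewrite [x + _]addrC subrK; case: yuv => ->; rewrite !inE eqxx ?orbT.
  by apply: shift_good => //; apply/ck_shift; rewrite cE oE.
- have [ta sa muE] := dk_pair E; have [ki kj] := third_neq ij.
  have ik : i != third i j by rewrite eq_sym.
  have jk : j != third i j by rewrite eq_sym.
  have zE : z = x + (mu s a - a) by rewrite muE; ring.
  (* The letter of the third part comes after or before y in the word, so that the word follows the
     cyclic order s. *)
  have [cE|cE] := eqVneq (ccw i j) s.
    have aE : a = x + y + (a - x - y) by ring.
    exists (inl (i, x), inl (j, y), inl (third i j, a - x - y), inl (i, z)).
      by rewrite !inE eqxx ?orbT.
    by rewrite zE {2 3}aE -cE; apply: pair_good => //; rewrite ?cE -?aE.
  have aE : a = x + (a - x - y) + y by ring.
  have cE' : ccw i (third i j) = s by rewrite (ccw_swap ij) //; move: cE; case: ccw; case: (s).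
  exists (inl (i, x), inl (third i j, a - x - y), inl (j, y), inl (i, z)).
    by rewrite !inE eqxx ?orbT.
  by rewrite zE {2 3}aE -cE'; apply: pair_good => //; rewrite ?cE' -?aE.
have [cu d2] := dk_cube E.
apply: (@cover_cube i j x y) => //.
  rewrite /= !cube_letterK ?cube_base2 ?cube_base1 //.
  by rewrite -(canon_two x d2) addrC subrK.
by rewrite /= !xpair_eqE (negbTE ij) [j == i]eq_sym (negbTE ij) /= orbT.
Qed.

Lemma cover_stem s i j x y t (X := complete i j x y (stem_sum s - x - y)) : i != j ->
  map3 (stem_letter s X) (map3 label t) = t -> distinct3 (map3 label t) -> covered t.
Proof.
move=> ij tE dt; have [tw Hw] := perm_extP dt.
exists (map4 (stem_letter s X) (perm_ext (map3 label t))).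
  by rewrite -{1}tE dels_map4 map_f.
apply: stem_good => //.
by rewrite /X /complete; case: i j ij {X tE} => [[]|] [[]|] //= _; ring.
Qed.

Lemma cover_ijk i j k x y z : i != j -> i != k -> j != k ->
  covered (inl (i, x), inl (j, y), inl (k, z)).
Proof.
move=> ij ik jk; case E: (tk (x + y + z)) => [s||].
- have sE := (tk_stem _ _).1 E.
  apply: (@cover_stem s i j x y) => //=; last first.
    by rewrite !inE !(inj_eq Some_inj) negb_or ij ik jk.
  rewrite /complete eqxx [j == i]eq_sym (negbTE ij) eqxx ![k == _]eq_sym.
  rewrite (negbTE ik) (negbTE jk).
  by congr (_, _, inl (_, _)); rewrite sE; ring.
- set a := x + y + z in E *; set s := ccw i j.
  case: (boolP (src s a)) => sa.
    exists (inl (i, x), inl (j, y), inl (k, z), inl (i, x + (mu s a - a))).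
      by rewrite !inE eqxx ?orbT.
    exact: pair_good.
  have ki : k != i by rewrite eq_sym.
  have kj : k != j by rewrite eq_sym.
  have cE : ccw k i = s by rewrite /s -(ccw_rot ki kj ij).
  have muE : z + (mu s a - a) + x + y = mu s a by rewrite {2}/a; ring.
  (* A sum that is not a source is the image of one: the word begins with the missing letter in part
     k, and k, i, j is in the same cyclic order as i, j, k. *)
  exists (inl (k, z + (mu s a - a)), inl (i, x), inl (j, y),
          inl (k, z + (mu s a - a) + (mu s (mu s a) - mu s a))).
    rewrite mu_inv // !inE; apply/orP; left; apply/eqP; congr (_, _, inl (_, _)); ring.
  rewrite -[in mu s (mu s a) - _]muE -cE; apply: pair_good => //; rewrite cE muE.
    exact: mu_pair.
  by rewrite src_mu.
have [cu a2] := tk_cube E.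
apply: (@cover_cube i j x y) => //.
  rewrite /= !cube_letterK ?cube_base1 ?(cube_base2 _ _ ij) ?(cube_base3 _ _ ik jk) //.
  by rewrite -(canon_two _ a2); congr canon; ring.
by rewrite /= !xpair_eqE (negbTE ij) (negbTE jk) (negbTE ik).
Qed.

Lemma cover_embed i t : essential small_f t -> covered (map3 (embed i) t).
Proof.
move=> et; exists (map4 (embed i) (e0 t)); last exact: inside_good.
by rewrite dels_map4 map_f //; case: (e0_design et).
Qed.

Lemma cover_inside i t : map3 (embed i) (map3 drop_part t) = t ->
  essential big_f t -> covered t.
Proof.
move=> tE; rewrite -tE (essential_map3 _ (@embed_inj i) (big_f_embed i)).
exact: cover_embed.
Qed.

Theorem big_design : design big_f big_ext.
Proof.
apply: design_of_words => -[[l1 l2] l3] et.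
case: l1 l2 l3 et => [[i x]|s1] [[j y]|s2] [[k z]|s3] et.
- have [ij|ij] := eqVneq i j.
    subst j; have [ik|ik] := eqVneq i k; first by subst k; apply: (@cover_inside i).
    by apply: cover_iij => //; case/and3P: et; rewrite letter_eqP.
  have [jk|jk] := eqVneq j k.
    by subst k; apply: cover_ijj => //; case/and3P: et => _; rewrite letter_eqP.
  have [ik|ik] := eqVneq i k; first by subst k; apply: cover_iji.
  exact: cover_ijk.
- have [ij|ij] := eqVneq i j; first by subst j; apply: (@cover_inside i).
  apply: (@cover_stem s3 i j x y) => //=.
    by rewrite /complete eqxx [j == i]eq_sym (negbTE ij) eqxx.
  by rewrite !inE (inj_eq Some_inj) orbF ij.
- have [ik|ik] := eqVneq i k; first by subst k; apply: (@cover_inside i).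
  apply: (@cover_stem s2 i k x z) => //=.
    by rewrite /complete eqxx [k == i]eq_sym (negbTE ik) eqxx.
  by rewrite !inE (inj_eq Some_inj) ik.
- exact: (@cover_inside i).
- have [jk|jk] := eqVneq j k; first by subst k; apply: (@cover_inside j).
  apply: (@cover_stem s1 j k y z) => //=.
    by rewrite /complete eqxx [k == j]eq_sym (negbTE jk) eqxx.
  by rewrite !inE (inj_eq Some_inj) jk.
- exact: (@cover_inside j).
- exact: (@cover_inside k).
exact: (@cover_inside None).
Qed.

(** * The subdesign on four letters *)

Variable c0 : C.
Hypothesis mate_c0 : forall x, mate c0 x = x + h.
Hypothesis ck_c0 : ck c0 true = ColorShift 0 /\ ck c0 false = ColorShift h.

Definition in_fibers (l : letter) : bool :=
  match l with
  | inl (i, x) => (i != Some false) && ((x == 0) || (x == h))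
  | inr _ => false
  end.

(** The only factor inside {0, h} is [c0], and its shifts are 0 and h, so words meeting both parts
    stay in the fibers. A triple inside one part uses a single pair of [big_f] and is not
    essential. *)
Lemma in_fibers_closed : closed_in in_fibers big_f big_ext.
Proof.
have [ct cf] := ck_c0.
have zh x : two x -> (x == 0) || (x == h) by case=> ->; rewrite eqxx ?orbT.
have dC d : two d -> exists o, dk d = ShiftColor c0 o.
  by case=> ->; [exists true|exists false]; apply/ck_shift.
have cC x y o : two x -> two y -> x != y -> exists2 d, ck (col x y) o = ColorShift d & two d.
  move=> x2 y2 xy; have -> : col x y = c0.
    rewrite -(col_mate c0 x) mate_c0; congr col.
    case: x2 y2 xy => -> [] ->; rewrite ?eqxx // ?add0r ?hh //.
  by case: o; [exists 0; last left|exists h; last right].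
have two2 x y : two x -> two y -> two (x - y) by move=> x2 y2; apply: twoD => //; apply: twoN.
have split_two (x : G) : (x == 0) || (x == h) -> two x.
  by case/orP=> /eqP->; [left|right].
have hT x : two x -> two (x + h) by move=> x2; apply: twoD => //; right.
split=> [[[i x]|s] //= /andP[-> /split_two x2] /=|]; first exact/zh/hT.
move=> [[i x]|//] [[j y]|//] [[k z]|//] et /andP[iP /split_two x2]
  /andP[jP /split_two y2] /andP[kP /split_two z2].
have [ij|ij] := eqVneq i j.
  subst j; have xy : x != y by case/and3P: et; rewrite letter_eqP.
  have [ik|ik] := eqVneq i k.
    subst k; have yz : y != z by case/and3P: et => _; rewrite letter_eqP.
    exfalso; move: et; rewrite /= !letter_eqP => /and3P[_ _].
    move: xy yz; case: x2 y2 z2 => -> [] -> [] ->; rewrite ?eqxx // ?add0r ?hh ?eqxx //.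
  have [d dE d2] := cC x y (lt x y) x2 y2 xy.
  by rewrite /= eqxx (negbTE ik) dE /= iP kP !zh //; apply: two2.
have [jk|jk] := eqVneq j k.
  subst k; have yz : y != z by case/and3P: et => _; rewrite letter_eqP.
  have [d dE d2] := cC y z (lt y z) y2 z2 yz.
  by rewrite /= eqxx (negbTE ij) dE /= iP kP !zh //; apply: twoD.
have [ik|ik] := eqVneq i k.
  subst k; have [o oE] := dC _ (two2 _ _ z2 x2).
  rewrite /= eqxx (negbTE ij) (negbTE jk) oE /orient mate_c0.
  by case: ifP => _ /=; rewrite iP jP !zh //; apply: hT.
by move: ij ik jk iP jP kP; case: i j k {et} => [[]|] [[]|] [[]|].
Qed.

(** * Doubling as a restriction of tripling *)

Definition two_parts (l : bool * G) : letter := inl (if l.1 then Some true else None, l.2).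
Definition part_of (l : letter) : bool * G :=
  match l with inl (i, x) => (i != None, x) | inr _ => (false, 0) end.
Definition double_f (l : bool * G) : bool * G := (l.1, l.2 + h).
Definition double_ext (t : (bool * G) * (bool * G) * (bool * G)) :=
  map4 part_of (big_ext (map3 two_parts t)).

Lemma two_partsK : cancel two_parts part_of.
Proof. by case=> -[] x. Qed.

Hypothesis no_stem : S -> False.
Hypothesis dk_all : forall d, exists c o, dk d = ShiftColor c o.
Hypothesis ck_nocube : forall c o, ck c o <> ColorCube.

(** When every difference is the shift of an oriented factor, no word on two parts needs a letter of
    the third. *)
Lemma double_design : design double_f double_ext.
Proof.
apply: (design_pullback (f := big_f) two_partsK) => // -[[[b1 x] [b2 y]] [b3 z]] et.
pose p (b : bool) : part := if b then Some true else None.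
have p_neq b b' : b != b' -> p b != p b' by case: b b' => -[].
have tag_neq b (u v : G) : (b, u) != (b, v) -> u != v by rewrite xpair_eqE eqxx.
have [e12|n12] := eqVneq b1 b2.
  subst b2; have xy : x != y by case/and3P: et => /tag_neq.
  have [e13|n13] := eqVneq b1 b3.
    subst b3.
    pose r (l : G + S) := (b1, if l is inl v then v else 0).
    have rE l : two_parts (r l) = embed (p b1) l by case: l => [//|s]; case: (no_stem s).
    have rE4 w : map4 two_parts (map4 r w) = map4 (embed (p b1)) w.
      by rewrite map4_comp; apply: eq_map4.
    pose t0 : (G + S) * (G + S) * (G + S) := (inl x, inl y, inl z).
    have et0 : essential small_f t0.
      rewrite -(essential_map3 _ (@embed_inj (p b1)) (big_f_embed (p b1))).
      by rewrite -(essential_map3 (f' := big_f) _ (can_inj two_partsK)) in et.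
    exists (map4 r (e0 t0)); rewrite rE4; last exact: inside_good.
    by rewrite dels_map4; apply: (map_f _ (proj1 (e0_design et0))).
  have p13 := p_neq _ _ n13.
  case E: (ck (col x y) (lt x y)) => [|d|]; last by case: (ck_nocube E).
    have [u [v [_ uv cE oE zuv]]] := orientP (lt x y) (col x y) z.
    exists ((b1, x), (b1, y), (b3, u), (b3, v)); last exact: plain_good.
    by case: zuv => ->; rewrite !inE eqxx ?orbT.
  exists ((b3, z - d), (b1, x), (b1, y), (b3, z - d + d)).
    by rewrite subrK !inE eqxx.
  by apply: shift_good => //; rewrite eq_sym.
have p12 := p_neq _ _ n12.
have [e23|n23] := eqVneq b2 b3.
  subst b3; have yz : y != z by case/and3P: et => _ /tag_neq.
  case E: (ck (col y z) (lt y z)) => [|d|]; last by case: (ck_nocube E).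
    have [u [v [_ uv cE oE xuv]]] := orientP (lt y z) (col y z) x.
    exists ((b1, u), (b1, v), (b2, y), (b2, z)).
      by case: xuv => ->; rewrite !inE eqxx ?orbT.
    by apply: plain_good; rewrite ?cE ?oE.
  exists ((b1, x), (b2, y), (b2, z), (b1, x + d)); last exact: shift_good.
  by rewrite !inE eqxx ?orbT.
have e13 : b3 = b1 by move: n12 n23; case: (b1); case: (b2); case: (b3).
subst b3; have [c [o dE]] := dk_all (z - x).
have [u [v [_ uv cE oE yuv]]] := orientP o c y.
exists ((b1, x), (b2, u), (b2, v), (b1, x + (z - x))).
  by rewrite [x + _]addrC subrK; case: yuv => ->; rewrite !inE eqxx ?orbT.
by apply: shift_good => //; apply/ck_shift; rewrite cE oE.
Qed.

Lemma double_closed :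
  closed_in [pred l : bool * G | (l.2 == 0) || (l.2 == h)] double_f double_ext.
Proof.
have [cf ce] := in_fibers_closed.
split=> [[b x] /= x2|a b c et a2 b2 c2].
  by have /andP[] := cf (inl (None, x)) x2.
have ip l : in_fibers (two_parts l) = (l.2 == 0) || (l.2 == h) by case: l => -[].
have pt l : in_fibers l -> ((part_of l).2 == 0) || ((part_of l).2 == h).
  by case: l => [[i x]|//] /andP[].
have := ce (two_parts a) (two_parts b) (two_parts c).
rewrite !ip -[essential big_f _]/(essential big_f (map3 two_parts (a, b, c))).
rewrite (essential_map3 (f := double_f) _ (can_inj two_partsK)) //.
move=> /(_ et a2 b2 c2); rewrite /double_ext -[map3 _ _]/(two_parts a, two_parts b, two_parts c).
by case: (big_ext _) => [[[x y] z] w] /and4P[/pt ? /pt ? /pt ? /pt ?]; apply/and4P.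
Qed.

End Composition.

(** * Normal form of an alphabet with an involution *)

Section Bijection.
Variables (L L' : eqType) (f : L -> L) (f' : L' -> L').
Variables (e : L * L * L -> L * L * L * L) (i : L' -> L) (r : L -> L').
Hypotheses (ik : cancel i r) (rk : cancel r i) (fi : forall x, f (i x) = i (f' x)).

Lemma design_bij : design f e -> design f' (fun t => map4 r (e (map3 i t))).
Proof.
move=> De; apply: design_pullback ik fi _ => t et.
have eit : essential f (map3 i t) by rewrite (essential_map3 _ (can_inj ik) fi).
have [te He] := De _ eit.
have E : map4 i (map4 r (e (map3 i t))) = e (map3 i t).
  by rewrite map4_comp; case: (e _) => [[[a b] c] d] /=; rewrite !rk.
by exists (map4 r (e (map3 i t))); rewrite E // => u ue.
Qed.

Lemma closed_in_bij P : closed_in P f e ->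
  closed_in (fun x => P (i x)) f' (fun t => map4 r (e (map3 i t))).
Proof.
move=> [Pf Pe]; split=> [x Px|a b c et Pa Pb Pc]; first by rewrite -fi Pf.
have := Pe (i a) (i b) (i c); rewrite -[essential f _]/(essential f (map3 i (a, b, c))).
rewrite (essential_map3 _ (can_inj ik) fi) => /(_ et Pa Pb Pc).
rewrite -[map3 i _]/(i a, i b, i c).
by case: (e _) => [[[x y] z] w] /=; rewrite !rk.
Qed.

End Bijection.

(** The element of order two, which serves as h. The shape [m.*2.+2] of the modulus gives ordinals
    their ring structure. *)
Definition midpoint m : 'I_m.*2.+2 := inord m.+1.

Lemma val_midpoint m : midpoint m = m.+1 :> nat.
Proof. by rewrite inordK; lia. Qed.

Lemma val_addI m (x y : 'I_m.*2.+2) :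
  (x + y)%R = (if x + y < m.*2.+2 then x + y else x + y - m.*2.+2) :> nat.
Proof.
have := ltn_ord x; have := ltn_ord y => hy hx.
rewrite /=; case: ifP => [/modn_small //|xy].
rewrite -[in LHS](@subnK m.*2.+2 (x + y)); last by lia.
by rewrite modnDr modn_small; lia.
Qed.

Lemma val_oppI m (x : 'I_m.*2.+2) :
  (- x)%R = (if x == 0 :> nat then 0 else m.*2.+2 - x) :> nat.
Proof.
rewrite /=; have := ltn_ord x; case: eqP => [->|/eqP x0] hx; first by rewrite subn0 modnn.
by rewrite modn_small; lia.
Qed.

Lemma val_add_midpoint m (x : 'I_m.*2.+2) :
  (x + midpoint m)%R = (if x < m.+1 then x + m.+1 else x - m.+1) :> nat.
Proof. by rewrite val_addI val_midpoint; have := ltn_ord x; do 2 case: ifP; lia. Qed.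

Section NormalForm.
Variables (L : finType) (f : L -> L) (P : pred L) (m : nat).
Hypotheses (f_inv : fpf_involution f) (Pf : forall x, P x -> P (f x)).
Hypothesis card_L : #|L| = m.*2.+2 + #|P|.

Let rk (x : L) : nat := enum_rank x.
Let H := [set x | ~~ P x & rk x < rk (f x)].

Lemma P_stable x : P (f x) = P x.
Proof.
have [fK _] := f_inv.
by apply/idP/idP => [/Pf|/Pf //]; rewrite fK.
Qed.

Lemma card_H : #|H| = m.+1.
Proof.
have [fK f_neq] := f_inv.
have rk_neq x : rk (f x) != rk x.
  by apply/eqP => /ord_inj/enum_rank_inj/eqP; apply/negP.
have HfE : f @: H = [set x | ~~ P x & rk (f x) < rk x].
  apply/setP => x; rewrite -{1}(fK x) mem_imset; last exact: can_inj fK.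
  by rewrite !inE fK P_stable.
have cfH : #|f @: H| = #|H| by rewrite card_imset //; apply: can_inj fK.
have dis : [disjoint H & f @: H].
  rewrite HfE -setI_eq0; apply/eqP/setP => x; rewrite !inE.
  by case: (P x) => //=; case: ltngtP.
have unE : H :|: f @: H = ~: [set x | P x].
  apply/setP => x; rewrite HfE !inE; case: (P x) => //=.
  by have := rk_neq x; case: ltngtP.
have := cardsUI H (f @: H); rewrite (disjoint_setI0 dis) cards0 addn0 unE cfH.
rewrite cardsCs setCK card_L.
have -> : #|[set x | P x]| = #|P| by rewrite cardsE.
by lia.
Qed.

Definition stem_type := {x : L | P x}.
Definition stem_f (s : stem_type) : stem_type := Sub (f (val s)) (Pf (valP s)).

Lemma stem_f_fpf : fpf_involution stem_f.
Proof.
have [fK f_neq] := f_inv; split=> s; first by apply: val_inj; rewrite /= fK.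
by rewrite -val_eqE /= f_neq.
Qed.

(** [H] holds one letter of each pair {x, f x} outside P. Numbering [H] by 0 .. m, and f x by m + 1
    more than x, turns f into addition of the midpoint. *)
Lemma normal_form : exists (i : 'I_m.*2.+2 + stem_type -> L) r,
  [/\ cancel i r, cancel r i & forall l, f (i l) = i (small_f (midpoint m) stem_f l)]
  /\ forall s, i (inr s) = val s.
Proof.
have [fK f_neq] := f_inv.
have HP : 0 < #|H| by rewrite card_H.
have [x0 x0H] : exists x0, x0 \in H by apply/card_gt0P.
pose a (k : nat) := nth x0 (enum H) k.
have szH : size (enum H) = m.+1 by rewrite -cardE card_H.
have aH k : k < m.+1 -> a k \in H by move=> km; rewrite -mem_enum mem_nth // szH.
have a_inj k k' : k < m.+1 -> k' < m.+1 -> a k = a k' -> k = k'.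
  by move=> km km' /eqP; rewrite nth_uniq ?szH ?enum_uniq // => /eqP.
have af k k' : k < m.+1 -> k' < m.+1 -> f (a k) = a k' -> False.
  move=> /aH; rewrite inE => /andP[_ h1] /aH; rewrite inE => /andP[_ h2] e.
  by move: h2; rewrite -e fK; lia.
pose i (l : 'I_m.*2.+2 + stem_type) : L :=
  match l with
  | inl x => if x < m.+1 then a x else f (a (x - m.+1))
  | inr s => val s
  end.
have iP x : ~~ P (i (inl x)).
  rewrite /i; have hx := ltn_ord x; case: ifP => hm; rewrite ?P_stable.
    by have := aH _ hm; rewrite inE => /andP[].
  have /aH : x - m.+1 < m.+1 by lia.
  by rewrite inE => /andP[].
have i_inj : injective i.
  move=> [x|s] [y|s'] /= E.
  - congr inl; apply: ord_inj; have hx := ltn_ord x; have hy := ltn_ord y.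
    move: E; case: ifP => xm; case: ifP => ym.
    + exact: a_inj.
    + by move=> /esym/af; case; lia.
    + by move/af; case; lia.
    + move=> /(can_inj fK)/a_inj E.
      have {}E : x - m.+1 = y - m.+1 by apply: E; lia.
      by lia.
  - by have := iP x; rewrite /= E (valP s').
  - by have := iP y; rewrite /= -E (valP s).
  - by congr inr; apply: val_inj.
have [r ik rk'] : bijective i.
  by apply: inj_card_bij => //; rewrite card_sum card_ord card_sig card_L.
exists i, r; split=> //; split=> // -[x|s] //.
rewrite /small_f /i val_add_midpoint; have hx := ltn_ord x.
have [xm|xm] := ltnP x m.+1.
  by rewrite ltnNge leq_addl /= addnK.
by rewrite fK; have -> : x - m.+1 < m.+1 by lia.
Qed.

End NormalForm.

(** * A one-factorization of the complete graph *)

Ltac split_ifs :=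
  repeat match goal with
  | H : context [if ?b then _ else _] |- _ => revert H; case_eq b; intros
  | |- context [if ?b then _ else _] => case_eq b; intros
  end.

Section Factorization.
Variable m : nat.
Notation G := 'I_m.*2.+2.
Notation color := 'I_m.*2.+1.

(* The standard one-factorization of the complete graph on Z/(2m+1) and a point at
   infinity, numbered 2m+1: the factor c pairs x with c - x, and c/2 with infinity. *)
Definition gk_double x := if x.*2 < m.*2.+1 then x.*2 else x.*2 - m.*2.+1.
Definition gk_mate c x :=
  if x == m.*2.+1 then (if odd c then (c + m.*2.+1)./2 else c./2)
  else if gk_double x == c then m.*2.+1
  else if x <= c then c - x else c + m.*2.+1 - x.
Definition gk_color x y :=
  if x == m.*2.+1 then gk_double y
  else if y == m.*2.+1 then gk_double x
  else if x + y < m.*2.+1 then x + y else x + y - m.*2.+1.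

Lemma gk_mateP c x : c < m.*2.+1 -> x < m.*2.+2 ->
  [/\ gk_mate c x < m.*2.+2, gk_mate c x != x & gk_color x (gk_mate c x) = c].
Proof.
move=> cN xg; rewrite /gk_color /gk_mate /gk_double.
by split; split_ifs; lia.
Qed.

Lemma gk_colorP x y : x < m.*2.+2 -> y < m.*2.+2 -> x != y ->
  gk_color x y < m.*2.+1 /\ gk_mate (gk_color x y) x = y.
Proof.
move=> xg yg xy; rewrite /gk_color /gk_mate /gk_double.
by split; split_ifs; lia.
Qed.

Lemma gk_colorC x y : x < m.*2.+2 -> y < m.*2.+2 -> gk_color x y = gk_color y x.
Proof. by move=> xg yg; rewrite /gk_color /gk_double; split_ifs; lia. Qed.

(* Relabelling under which the factor 0 pairs x with x + m + 1 in Z/(2m+2). *)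
Definition gk_fold x := if x < m.+1 then x else m.*2.+1 + m.+1 - x.

Lemma gk_foldP x : x < m.*2.+2 -> gk_fold x < m.*2.+2 /\ gk_fold (gk_fold x) = x.
Proof. by move=> xg; rewrite /gk_fold; split; split_ifs; lia. Qed.

Definition color_of (x y : G) : color := inord (gk_color (gk_fold x) (gk_fold y)).
Definition mate (c : color) (x : G) : G := inord (gk_fold (gk_mate c (gk_fold x))).

Lemma val_mate c x : mate c x = gk_fold (gk_mate c (gk_fold x)) :> nat.
Proof.
rewrite inordK //; have [xg _] := gk_foldP (ltn_ord x).
by have [/gk_foldP[]] := gk_mateP (ltn_ord c) xg.
Qed.

Lemma color_ofC x y : color_of y x = color_of x y.
Proof.
have [xg _] := gk_foldP (ltn_ord x); have [yg _] := gk_foldP (ltn_ord y).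
by rewrite /color_of gk_colorC.
Qed.

Lemma mate_color x y : x != y -> mate (color_of x y) x = y.
Proof.
move=> xy; have [xg xK] := gk_foldP (ltn_ord x); have [yg yK] := gk_foldP (ltn_ord y).
have fxy : gk_fold x != gk_fold y.
  by apply: contra xy => /eqP E; apply/eqP/ord_inj; rewrite -xK -yK E.
have [cN mE] := gk_colorP xg yg fxy.
by apply: ord_inj; rewrite val_mate inordK // mE.
Qed.

Lemma mate_neq c x : mate c x != x.
Proof.
have [xg xK] := gk_foldP (ltn_ord x); have [mg mx _] := gk_mateP (ltn_ord c) xg.
apply: contra mx => /eqP/(congr1 val)/=; rewrite val_mate => /(congr1 gk_fold).
by have [_ ->] := gk_foldP mg; move=> ->.
Qed.

Lemma color_of_mate c x : color_of x (mate c x) = c.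
Proof.
have [xg xK] := gk_foldP (ltn_ord x); have [mg _ cE] := gk_mateP (ltn_ord c) xg.
apply: ord_inj; rewrite /color_of val_mate; have [_ ->] := gk_foldP mg.
by rewrite cE inordK.
Qed.

Lemma mate0 x : mate ord0 x = (x + midpoint m)%R.
Proof.
apply: ord_inj; rewrite val_mate val_add_midpoint /gk_fold /gk_mate /gk_double /=.
by have := ltn_ord x; split_ifs; lia.
Qed.

Lemma midpointD : (midpoint m + midpoint m = 0)%R.
Proof. by apply: ord_inj; rewrite val_add_midpoint val_midpoint; split_ifs; rewrite /=; lia. Qed.

Definition upper (x : G) : bool := m < x.

Lemma upper_midpoint x : upper (x + midpoint m)%R = ~~ upper x.
Proof. by rewrite /upper val_add_midpoint; have := ltn_ord x; split_ifs; lia. Qed.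

Definition ltG : rel G := fun x y => x < y.

Lemma ltG_asym x y : x != y -> ltG y x = ~~ ltG x y.
Proof. by rewrite /ltG => xy; have : x != y :> nat by []; lia. Qed.

End Factorization.

(** * Sums and differences for tripling *)

Definition has_design q := exists (L : finType) (f : L -> L) e,
  [/\ #|L| = q, fpf_involution f & design f e].

Definition has_design4 q := exists (L : finType) (f : L -> L) e (P : pred L),
  [/\ #|L| = q, fpf_involution f, design f e, #|P| = 4 & closed_in P f e].

Lemma val_subI m (x y : 'I_m.*2.+2) :
  (x - y)%R = (if y <= x then x - y else m.*2.+2 + x - y) :> nat.
Proof.
rewrite val_addI val_oppI; have := ltn_ord x; have := ltn_ord y.
by split_ifs; lia.
Qed.

Section Starter.
Variables (m : nat) (wide : bool).
Hypothesis wide_m : wide -> 0 < m.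

(* The sums outside [stem_sums] form two blocks of consecutive integers, 0 .. 2w without
   its centre w = m./2 and 2w+1 .. 2m (without its ends when [wide]); [reflect_sum]
   reverses each block, so that the differences it realizes are the even ones in one
   block and the odd ones in the other. *)
Definition stem_sums : seq nat :=
  [:: m./2; m.*2.+1] ++ (if wide then [:: (m./2).*2.+1; m.*2] else [::]).
Definition reflect_sum t :=
  if t <= (m./2).*2 then (m./2).*2 - t else (m./2).*2 + m.*2.+1 - t.
(** Distance between the ends of the second block: when these ends are stem sums, this difference
    and its opposite are left unrealized. *)
Definition gap := m.*2 - (m./2).*2.+1.
Definition spare_shifts : seq nat :=
  [:: 0; m.+1] ++ (if wide then [:: gap; m.*2.+2 - gap] else [::]).
(** Inverse of the difference map: the parity of d gives the block, and the source is the lower sum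
    of its pair when d < m + 1, the upper one otherwise. *)
Definition source_of d :=
  if d < m.+1 then (if odd d then ((m./2).*2 + m.*2.+1 - d)./2 else m./2 - d./2)
  else (if odd d then ((m./2).*2 + m.*2.+1 + (m.*2.+2 - d))./2
        else m./2 + (m.*2.+2 - d)./2).
Definition diff t t' := if t <= t' then t' - t else m.*2.+2 + t' - t.

Lemma reflect_sumP t : t < m.*2.+2 -> t \notin stem_sums ->
  [/\ reflect_sum t < m.*2.+2, reflect_sum t \notin stem_sums,
      reflect_sum (reflect_sum t) = t & reflect_sum t != t].
Proof.
move=> tg; rewrite /stem_sums; case: wide wide_m => [/(_ isT)|_];
  rewrite /= !inE /reflect_sum; move=> ?; split; split_ifs; lia.
Qed.

Lemma diff_reflect t : t < m.*2.+2 -> t \notin stem_sums ->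
  [/\ diff t (reflect_sum t) < m.*2.+2, diff t (reflect_sum t) \notin spare_shifts,
      source_of (diff t (reflect_sum t)) = t
    & (t < reflect_sum t) = (diff t (reflect_sum t) < m.+1)].
Proof.
move=> tg; rewrite /stem_sums /spare_shifts /gap; case: wide wide_m => [/(_ isT)|_];
  rewrite /= !inE /reflect_sum /source_of /diff; move=> ?; split; split_ifs; lia.
Qed.

Lemma source_ofP d : d < m.*2.+2 -> d \notin spare_shifts ->
  [/\ source_of d < m.*2.+2, source_of d \notin stem_sums
    & diff (source_of d) (reflect_sum (source_of d)) = d].
Proof.
move=> dg; rewrite /stem_sums /spare_shifts /gap; case: wide wide_m => [/(_ isT)|_];
  rewrite /= !inE /reflect_sum /source_of /diff; move=> ?; split; split_ifs; lia.
Qed.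

End Starter.

(** * Doubling *)

Lemma big_f_fpf (G : comNzRingType) (S : eqType) (h : G) (fS : S -> S) :
  (h + h = 0)%R -> h != 0%R -> fpf_involution fS -> fpf_involution (big_f h fS).
Proof.
move=> hh h0 [fK f_neq]; split=> -[[i x]|s] /=.
- by rewrite -addrA hh addr0.
- by rewrite fK.
- by rewrite letter_eqP -subr_eq0 addrAC subrr add0r.
- exact: f_neq.
Qed.

Lemma midpoint_neq0 m : midpoint m != 0%R.
Proof. by apply/eqP => /(congr1 val) /=; rewrite val_midpoint. Qed.

Section Doubling.
Variable m : nat.
Notation G := 'I_m.*2.+2.

(** The first m + 1 factors, in both orientations, absorb all 2m + 2 differences; factor 0 gets 0
    and m + 1, as [in_fibers_closed] requires. *)
Definition double_ck (c : 'I_m.*2.+1) (o : bool) : color_kind G :=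
  if c < m.+1 then ColorShift (inord (if o then c : nat else c + m.+1)) else ColorPlain.
Definition double_dk (d : G) : shift_kind G 'I_m.*2.+1 :=
  ShiftColor (inord (if d < m.+1 then d : nat else d - m.+1)) (d < m.+1).

Lemma double_ck_dk c o d : double_ck c o = ColorShift d <-> double_dk d = ShiftColor c o.
Proof.
rewrite /double_ck /double_dk; have hd := ltn_ord d; have hc := ltn_ord c; split.
  case: ifP => // cm [<-]; have E : (if o then (c : nat) else c + m.+1) < m.*2.+2.
    by case: o; lia.
  rewrite inordK //; congr ShiftColor; last by case: o {E}; lia.
  by apply: ord_inj; case: o {E}; split_ifs; rewrite ?inordK; lia.
case=> <- <-; have E : (if d < m.+1 then d : nat else d - m.+1) < m.*2.+1 by split_ifs; lia.
rewrite inordK //; case: ifP => [_|]; last by move: E; split_ifs; lia.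
by congr ColorShift; apply: ord_inj; split_ifs; rewrite inordK; lia.
Qed.

Lemma doubling : has_design m.*2.+2 -> has_design4 (2 * m.*2.+2).
Proof.
case=> L [f [e [cardL f_inv De]]].
have P0 x : (pred0 : pred L) x -> (pred0 : pred L) (f x) by [].
have cardL' : #|L| = m.*2.+2 + #|(pred0 : pred L)| by rewrite card0 addn0.
have [i [r [[ik rk fi] _]]] := normal_form f_inv P0 cardL'.
pose S := stem_type (pred0 : pred L).
have noS : S -> False by case.
pose e0 t := map4 r (e (map3 i t)).
have De0 : design (small_f (midpoint m) (stem_f P0)) e0 := design_bij ik rk fi De.
have sc s1 s2 s3 : essential (stem_f P0) (s1, s2, s3) ->
    exists w, e0 (inr s1, inr s2, inr s3) = map4 inr w by case: (noS s1).
pose tk (a : G) : sum_kind S := SumCube.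
pose ss (s : S) : G := 0%R.
pose mu (_ : bool) (x : G) := x.
pose src (_ : bool) (x : G) := true.
pose E := double_ext (midpoint m) e0 (@color_of m) (@mate m) (@ltG m) double_ck double_dk
  tk ss mu src (@upper m).
have hh := midpointD m.
exists (bool * G)%type, (double_f (midpoint m)), E, [pred l | (l.2 == 0%R) || (l.2 == midpoint m)].
split.
- by rewrite card_prod card_bool card_ord.
- split=> -[b x]; rewrite /double_f /= ?xpair_eqE; first by rewrite -addrA hh addr0.
  by rewrite eqxx /= -subr_eq0 addrAC subrr add0r midpoint_neq0.
- apply: double_design De0 sc (@ltG_asym m) (@color_ofC m) (@mate_color m) (@mate_neq m)
    (@color_of_mate m) double_ck_dk noS _ _.
  + by move=> d; do 2 eexists.
  + by move=> c o; rewrite /double_ck; case: ifP.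
- transitivity #|[predX (predT : pred bool) & pred2 (0%R : G) (midpoint m)]|.
    by apply: eq_card => -[b x]; rewrite !inE.
  by rewrite cardX cardT enumT /= unlock /= card2 eq_sym midpoint_neq0.
apply: (@double_closed _ _ _ _ (stem_f P0) _ _ _ _ _ _ _ _ _ _ _
  (@color_of_mate m) double_ck_dk hh ord0 (@mate0 m)).
split; rewrite /double_ck /=; congr ColorShift; apply: ord_inj;
  by rewrite inordK ?val_midpoint.
Qed.

End Doubling.

(** * Tripling *)

Lemma sum_kindP (S : finType) (G : eqType) (g : S -> G) (a : G) :
  injective g ->
  let k := if [pick s | g s == a] is Some s then SumStem s else SumPair in
  (forall s, k = SumStem s <-> g s = a) /\ k <> SumCube /\
  (k = SumPair <-> forall s, g s != a).
Proof.
move=> g_inj /=; case: pickP => [s /eqP sa|no]; split.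
- by move=> s'; split=> [[<-]|]; rewrite // -sa => /g_inj->.
- by split=> //; split=> // /(_ s); rewrite sa eqxx.
- by move=> s'; split=> // /eqP; rewrite no.
- by split=> //; split=> // _ s; rewrite no.
Qed.

Section StemTripling.
Variables (m : nat) (wide : bool).
Hypothesis wide_m : wide -> 0 < m.
Notation G := 'I_m.*2.+2.
Notation color := 'I_m.*2.+1.
Notation sums := (stem_sums m wide).

Lemma sums_lt t : t \in sums -> t < m.*2.+2.
Proof.
by rewrite /stem_sums; case: wide wide_m => [/(_ isT)|_]; rewrite /= !inE; lia.
Qed.

Lemma sums_uniq : uniq sums.
Proof.
by rewrite /stem_sums; case: wide wide_m => [/(_ isT)|_]; rewrite /= !inE; lia.
Qed.

(** The boolean under [inord] is the index of the factor: 0 and m + 1 go to factor 0, [gap] and its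
    opposite to factor 1. *)
Definition stem_dk (d : G) : shift_kind G color :=
  if (d : nat) \in spare_shifts m wide then
    ShiftColor (inord (wide && (((d : nat) == gap m) || ((d : nat) == m.*2.+2 - gap m)) : nat))
      (d < m.+1)
  else ShiftPair (d < m.+1) (inord (source_of m d)).
Definition stem_ck (c : color) (o : bool) : color_kind G :=
  if (c : nat) == 0 then ColorShift (if o then 0%R else midpoint m)
  else if wide && ((c : nat) == 1)
       then ColorShift (inord (if o then gap m else m.*2.+2 - gap m))
  else ColorPlain.

Lemma stem_ck_dk c o d : stem_ck c o = ColorShift d <-> stem_dk d = ShiftColor c o.
Proof.
rewrite /stem_ck /stem_dk /spare_shifts /gap; have hd := ltn_ord d; have hc := ltn_ord c.
set W := wide; have Wm : W -> 0 < m := wide_m; case: W Wm => /= [/(_ isT) m0|_].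
  split.
    case: ifP => [/eqP c0 [<-]|c0].
      case: o; rewrite ?val_midpoint !inE ?eqxx ?orbT /=.
        congr ShiftColor; apply: ord_inj; rewrite inordK; lia.
      rewrite ltnn; congr ShiftColor; apply: ord_inj; rewrite inordK; lia.
    case: ifP => // /eqP c1 [<-]; rewrite inordK; last by case: o; lia.
    rewrite !inE; case: o; rewrite !eqxx ?orbT; congr ShiftColor; try lia;
      by apply: ord_inj; rewrite inordK; lia.
  rewrite !inE; case: ifP => // dS [<- <-].
  rewrite inordK; last by case: (_ || _); lia.
  case: (boolP (_ || _)) => /= dg; congr ColorShift; apply: ord_inj; rewrite ?inordK;
    case: ifP; rewrite ?val_midpoint /=; lia.
split.
  case: ifP => // /eqP c0 [<-]; case: o; rewrite ?val_midpoint !inE ?eqxx ?orbT /=.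
    congr ShiftColor; apply: ord_inj; rewrite inordK; lia.
  rewrite ltnn; congr ShiftColor; apply: ord_inj; rewrite inordK; lia.
rewrite !inE; case: ifP => // dS [<- <-]; rewrite inordK //=.
congr ColorShift; apply: ord_inj; case: ifP; rewrite ?val_midpoint /=; lia.
Qed.

Lemma stem_ck_cube c o : stem_ck c o <> ColorCube.
Proof. by rewrite /stem_ck; do 2 case: ifP. Qed.

Lemma stem_dk_cube d : stem_dk d <> ShiftCube.
Proof. by rewrite /stem_dk; case: ifP. Qed.

Variables (S : finType) (card_S : #|S| = size sums).

Definition stem_sumG (s : S) : G := inord (nth 0 sums (enum_rank s)).

Lemma rank_lt (s : S) : enum_rank s < size sums.
Proof. by rewrite -card_S. Qed.

Lemma val_stem_sumG s : stem_sumG s = nth 0 sums (enum_rank s) :> nat.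
Proof. by rewrite inordK //; apply: sums_lt; apply: mem_nth; apply: rank_lt. Qed.

Lemma stem_sumG_inj : injective stem_sumG.
Proof.
move=> s s' /(congr1 val) /=; rewrite !val_stem_sumG => /eqP.
by rewrite nth_uniq ?rank_lt ?sums_uniq // => /eqP/ord_inj/enum_rank_inj.
Qed.

Lemma stem_sumG_notin (a : G) : (forall s, stem_sumG s != a) <-> (a : nat) \notin sums.
Proof.
split=> [no|aS s]; last first.
  apply: contra aS => /eqP<-; rewrite val_stem_sumG mem_nth //; exact: rank_lt.
apply/negP => aS.
have ai : index (a : nat) sums < #|S| by rewrite card_S index_mem.
have := no (enum_val (Ordinal ai)); rewrite -val_eqE /= val_stem_sumG enum_valK /=.
by rewrite nth_index // eqxx.
Qed.

Definition stem_tk (a : G) : sum_kind S :=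
  if [pick s | stem_sumG s == a] is Some s then SumStem s else SumPair.

Lemma stem_tkS a s : stem_tk a = SumStem s <-> stem_sumG s = a.
Proof. by have [] := sum_kindP a stem_sumG_inj. Qed.

Lemma stem_tkC a : stem_tk a <> SumCube.
Proof. by have [_ []] := sum_kindP a stem_sumG_inj. Qed.

Lemma stem_tkP a : stem_tk a = SumPair <-> (a : nat) \notin sums.
Proof. by rewrite -stem_sumG_notin; have [_ [_]] := sum_kindP a stem_sumG_inj. Qed.

Definition stem_mu (s : bool) (a : G) : G := inord (reflect_sum m a).
(** Both cyclic orders use the same reflection with opposite sources, so one realizes differences
    below m + 1 and the other their opposites. *)
Definition stem_src (s : bool) (a : G) : bool := (a < reflect_sum m a) == s.

Lemma val_stem_mu s a : stem_tk a = SumPair -> stem_mu s a = reflect_sum m a :> nat.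
Proof. by move/stem_tkP=> aP; rewrite inordK //; have [] := reflect_sumP wide_m (ltn_ord a) aP. Qed.

Lemma stem_mu_pair s a : stem_tk a = SumPair -> stem_tk (stem_mu s a) = SumPair.
Proof.
move=> ta; apply/stem_tkP; rewrite (val_stem_mu _ ta).
by move/stem_tkP: ta => /(reflect_sumP wide_m (ltn_ord a))[].
Qed.

Lemma stem_mu_inv s a : stem_tk a = SumPair -> stem_mu s (stem_mu s a) = a.
Proof.
move=> ta; apply: ord_inj; rewrite (val_stem_mu _ (stem_mu_pair s ta)) (val_stem_mu _ ta).
by move/stem_tkP: ta => /(reflect_sumP wide_m (ltn_ord a))[].
Qed.

Lemma stem_src_mu s a : stem_tk a = SumPair ->
  stem_src s (stem_mu s a) = ~~ stem_src s a.
Proof.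
move=> ta; rewrite /stem_src (val_stem_mu _ ta).
move/stem_tkP: ta => /(reflect_sumP wide_m (ltn_ord a))[_ _ -> ne].
by case: s; lia.
Qed.

Lemma stem_dk_src s a : stem_tk a = SumPair -> stem_src s a ->
  stem_dk (stem_mu s a - a)%R = ShiftPair s a.
Proof.
move=> ta sa; have aP := (stem_tkP a).1 ta.
have [dg dS sE lE] := diff_reflect wide_m (ltn_ord a) aP.
have vE : (stem_mu s a - a)%R = diff m a (reflect_sum m a) :> nat.
  by rewrite val_subI (val_stem_mu _ ta).
rewrite /stem_dk vE (negbTE dS) -lE sE.
by rewrite (eqP sa) inord_val.
Qed.

Lemma stem_dk_pair d s a : stem_dk d = ShiftPair s a ->
  [/\ stem_tk a = SumPair, stem_src s a & stem_mu s a = (a + d)%R].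
Proof.
rewrite /stem_dk; case: ifP => // /negbT dS [sE aE].
have [ag aS dE] := source_ofP wide_m (ltn_ord d) dS.
have va : a = source_of m d :> nat by rewrite -aE inordK.
have ta : stem_tk a = SumPair by apply/stem_tkP; rewrite va.
split=> //.
  rewrite /stem_src -sE va; have [_ _ _ ->] := diff_reflect wide_m ag aS.
  by rewrite dE eqxx.
apply: (addIr (- a)%R); rewrite addrAC subrr add0r; apply: ord_inj.
by rewrite val_subI (val_stem_mu _ ta) va.
Qed.

End StemTripling.

Lemma card_in_fibers (G : finComNzRingType) (S : finType) (h : G) : h != 0%R ->
  #|(in_fibers h : pred (part * G + S))| = 4.
Proof.
move=> h0.
have -> : #|(in_fibers h : pred (part * G + S))| =
    #|inl @: setX [set None; Some true] [set 0%R; h] : {set (part * G + S)}|.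
  apply: eq_card => l; apply/idP/imsetP.
    case: l => [[i x]|s] // /andP[ip xh]; exists (i, x) => //.
    by rewrite !inE /= xh andbT; case: i ip => [[]|].
  case=> -[i x]; rewrite !inE /= => /andP[ip xh] ->.
  by rewrite unfold_in /= xh andbT; case: i ip => [[]|].
by rewrite card_imset ?cardsX ?cards2 ?[0%R == h]eq_sym ?h0 // => x y [].
Qed.

Lemma stem_tripling m (wide : bool) (L : finType) (f : L -> L) e (P : pred L) :
  (wide -> 0 < m) -> fpf_involution f -> design f e -> closed_in P f e ->
  #|P| = (if wide then 4 else 2) -> #|L| = m.*2.+2 + #|P| ->
  has_design4 (3 * m.*2.+2 + #|P|).
Proof.
move=> wide_m f_inv De [Pf Pe] cardP cardL.
have [i [r [[ik rk fi] iS]]] := normal_form f_inv Pf cardL.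
pose S : finType := {x : L | P x}; pose fS : S -> S := stem_f Pf.
pose e0 t := map4 r (e (map3 i t)).
have De0 : design (small_f (midpoint m) fS) e0 := design_bij ik rk fi De.
have rS x (Px : P x) : exists s : S, r x = inr s.
  by exists (Sub x Px); rewrite -(ik (inr (Sub x Px))) iS SubK.
have sc s1 s2 s3 : essential fS (s1, s2, s3) ->
    exists w, e0 (inr s1, inr s2, inr s3) = map4 inr w.
  move=> es; have := Pe (val s1) (val s2) (val s3).
  have -> : essential f (val s1, val s2, val s3).
    by rewrite -[X in essential f X]/(map3 val (s1, s2, s3))
               (essential_map3 (f := fS) _ val_inj).
  move=> /(_ isT (valP s1) (valP s2) (valP s3)).
  rewrite /e0 /= !iS; case: (e _) => [[[x y] z] w] /and4P[Px Py Pz Pw] /=.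
  have [[s1' ->] [s2' ->]] := (rS _ Px, rS _ Py).
  have [[s3' ->] [s4' ->]] := (rS _ Pz, rS _ Pw).
  by exists (s1', s2', s3', s4').
have card_S : #|S| = size (stem_sums m wide).
  by rewrite card_sig cardP /stem_sums; case: (wide).
pose ss := @stem_sumG m wide S.
pose E := big_ext (midpoint m) e0 (@color_of m) (@mate m) (@ltG m) (@stem_ck m wide)
  (@stem_dk m wide) (@stem_tk m wide S) ss (@stem_mu m) (@stem_src m) (@upper m).
have hh := midpointD m.
exists (part * 'I_m.*2.+2 + S)%type, (big_f (midpoint m) fS), E, (in_fibers (midpoint m)).
split.
- by rewrite card_sum card_prod card_option card_bool card_ord card_sig.
- by apply: big_f_fpf => //; [exact: midpoint_neq0|exact: stem_f_fpf].
- apply: (@big_design _ _ _ _ _ _ _ _ _ _ _ _ _ _ _ _ false De0 sc (@ltG_asym m)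
    (@color_ofC m) (@mate_color m) (@mate_neq m) (@color_of_mate m) (stem_ck_dk wide_m)
    (stem_tkS wide_m card_S) (stem_mu_pair wide_m card_S) (stem_mu_inv wide_m card_S)
    (stem_src_mu wide_m card_S) (stem_dk_src wide_m card_S) (stem_dk_pair wide_m card_S)
    hh (@upper_midpoint m)) => //.
  + by move=> c o /stem_ck_cube.
  + by move=> d /stem_dk_cube.
  + by move=> a /(stem_tkC wide_m card_S).
- exact/card_in_fibers/midpoint_neq0.
exact: (@in_fibers_closed _ _ _ _ _ _ _ _ _ _ _ _ _ _ _ _ (@color_of_mate m)
  (stem_ck_dk wide_m) hh ord0 (@mate0 m)).
Qed.

(** Any pair {a, f a} can serve as the stem, since no triple on it is essential. *)
Lemma tripling2 m : has_design (m.*2.+2 + 2) -> has_design4 (3 * m.*2.+2 + 2).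
Proof.
case=> L [f [e [cardL f_inv De]]]; have [fK f_neq] := f_inv.
have [a _] : exists a, a \in L by apply/card_gt0P; rewrite cardL addnC.
have card2P : #|pred2 a (f a)| = 2 by rewrite card2 eq_sym f_neq.
have := @stem_tripling m false L f e (pred2 a (f a)); rewrite card2P; apply=> //.
have f2 x : pred2 a (f a) x -> x = a \/ x = f a by case/orP=> /eqP->; [left|right].
split=> [x /f2[]->|x y z /and3P[xy yz xz] /f2 xa /f2 ya /f2 za].
- by rewrite /= eqxx orbT.
- by rewrite /= fK eqxx.
exfalso; move: xy yz xz; case: xa => ->; case: ya => ->; case: za => ->;
  by rewrite ?fK ?eqxx.
Qed.

Lemma tripling4 m : 0 < m -> has_design4 (m.*2.+2 + 4) -> has_design4 (3 * m.*2.+2 + 4).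
Proof.
move=> m_gt0 [L [f [e [P [cardL f_inv De cardP cP]]]]].
by have := @stem_tripling m true L f e P; rewrite cardP; apply.
Qed.

Section CubeTripling.
Variable m : nat.
Hypothesis m_even : ~~ odd m.
Notation G := 'I_m.*2.+2.

Definition cube_tk (S : Type) (a : G) : sum_kind S :=
  if (a == 0%R) || (a == midpoint m) then SumCube else SumPair.
Definition cube_ck (c : 'I_m.*2.+1) (o : bool) : color_kind G :=
  if c == ord0 then ColorCube else ColorPlain.
(** As m is even, h is odd and doubling permutes the even residues. Order [true] sends an even a to
    2a + h, with odd difference a + h, and an odd a to the even b with 2b + h = a; order [false]
    sends a to -a, with even difference -2a. Taken from the sources, these are all the differences
    except 0 and h, once each. *)
Definition cube_mu (s : bool) (a : G) : G :=
  if s then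
    if odd a then let b := (if m < a then a - m.+1 else a + m.+1)./2 in
                  inord (if odd b then (if b < m.+1 then b + m.+1 else b - m.+1) else b)
    else (a + a + midpoint m)%R
  else (- a)%R.
Definition cube_src (s : bool) (a : G) : bool := if s then ~~ odd a else a < m.+1.
Definition cube_dk (d : G) : shift_kind G 'I_m.*2.+1 :=
  if (d == 0%R) || (d == midpoint m) then ShiftCube
  else if odd d then ShiftPair true (d + midpoint m)%R
  else ShiftPair false (inord (m.*2.+2 - d)./2).

Lemma zero_midpointE (a : G) :
  ((a == 0%R) || (a == midpoint m)) = (a == 0 :> nat) || (a == m.+1 :> nat).
Proof. by rewrite -!val_eqE /= val_midpoint. Qed.

Lemma cube_tkP S a : cube_tk S a = SumPair <-> (a != 0 :> nat) && (a != m.+1 :> nat).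
Proof. by rewrite /cube_tk zero_midpointE -negb_or; case: (_ || _). Qed.

Lemma val_cube_mu s (a : G) : cube_mu s a =
  (if s then
    if odd a then let b := (if m < a then a - m.+1 else a + m.+1)./2 in
                  (if odd b then (if b < m.+1 then b + m.+1 else b - m.+1) else b)
    else if a.*2 + m.+1 < m.*2.+2 then a.*2 + m.+1
         else if a.*2 + m.+1 < m.*2.+2.*2 then a.*2 + m.+1 - m.*2.+2
         else a.*2 + m.+1 - m.*2.+2.*2
  else if a == 0 :> nat then 0 else m.*2.+2 - a) :> nat.
Proof.
have ha := ltn_ord a; rewrite /cube_mu; case: s; last by rewrite val_oppI.
case: ifP => oa; first by rewrite inordK //=; split_ifs; lia.
by rewrite val_addI val_midpoint val_addI; split_ifs; lia.
Qed.

Lemma cube_mu_pair S s a :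
  cube_tk S a = SumPair -> cube_tk S (cube_mu s a) = SumPair.
Proof.
move=> /cube_tkP ta; apply/cube_tkP; rewrite val_cube_mu /=; have ha := ltn_ord a.
by case: s; split_ifs; lia.
Qed.

Lemma cube_mu_inv S s a : cube_tk S a = SumPair -> cube_mu s (cube_mu s a) = a.
Proof.
move=> /cube_tkP ta; apply: ord_inj; rewrite val_cube_mu val_cube_mu /=.
have ha := ltn_ord a.
by case: s; split_ifs; lia.
Qed.

Lemma cube_src_mu S s a : cube_tk S a = SumPair ->
  cube_src s (cube_mu s a) = ~~ cube_src s a.
Proof.
move=> /cube_tkP ta; rewrite /cube_src val_cube_mu /=; have ha := ltn_ord a.
by case: s; split_ifs; lia.
Qed.

Lemma cube_dk_src S s a : cube_tk S a = SumPair -> cube_src s a ->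
  cube_dk (cube_mu s a - a)%R = ShiftPair s a.
Proof.
move=> /cube_tkP ta; rewrite /cube_src /cube_dk zero_midpointE val_subI val_cube_mu /=.
have ha := ltn_ord a; case: s => [/negbTE oa|am]; rewrite ?oa.
  rewrite ifN; last by split_ifs; lia.
  rewrite ifT; last by split_ifs; lia.
  by congr ShiftPair; rewrite /cube_mu oa -[RHS]addr0 -(midpointD m); ring.
rewrite ifN; last by split_ifs; lia.
rewrite ifN; last by split_ifs; lia.
by congr ShiftPair; apply: ord_inj; rewrite inordK; split_ifs; lia.
Qed.

Lemma cube_dk_pair S d s a : cube_dk d = ShiftPair s a ->
  [/\ cube_tk S a = SumPair, cube_src s a & cube_mu s a = (a + d)%R].
Proof.
rewrite /cube_dk zero_midpointE; have hd := ltn_ord d; case: ifP => // d0.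
case: ifP => od [<- <-].
  have ea : odd (d + midpoint m)%R = false by rewrite val_add_midpoint; split_ifs; lia.
  split; first by apply/cube_tkP; rewrite val_add_midpoint; split_ifs; lia.
    by rewrite /cube_src ea.
  rewrite /cube_mu ea; have hh := midpointD m.
  rewrite -[X in _ = X]addr0 -hh; ring.
have va : (inord (m.*2.+2 - d)./2 : G) = (m.*2.+2 - d)./2 :> nat by rewrite inordK; lia.
split; first by apply/cube_tkP; rewrite va; lia.
  by rewrite /cube_src va; lia.
by apply: ord_inj; rewrite val_cube_mu val_addI va; split_ifs; lia.
Qed.

Lemma cube_tripling (L : finType) (f : L -> L) e (Q : pred L) :
  #|L| = m.*2.+2 -> fpf_involution f -> design f e -> closed_in Q f e ->
  exists (L' : finType) (f' : L' -> L') e' (Q' : pred L'),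
    [/\ #|L'| = 3 * m.*2.+2, fpf_involution f', design f' e', #|Q'| = #|Q|
      & closed_in Q' f' e'].
Proof.
move=> cardL f_inv De cQ.
have P0 x : (pred0 : pred L) x -> (pred0 : pred L) (f x) by [].
have cardL' : #|L| = m.*2.+2 + #|(pred0 : pred L)| by rewrite card0 addn0.
have [i [r [[ik rk fi] _]]] := normal_form f_inv P0 cardL'.
pose S : finType := {x : L | (pred0 : pred L) x}; pose fS : S -> S := stem_f P0.
have noS : S -> False by case.
pose e0 t := map4 r (e (map3 i t)).
have De0 : design (small_f (midpoint m) fS) e0 := design_bij ik rk fi De.
have cQ0 : closed_in (fun x => Q (i x)) (small_f (midpoint m) fS) e0 :=
  closed_in_bij ik rk fi cQ.
have sc s1 s2 s3 : essential fS (s1, s2, s3) ->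
    exists w, e0 (inr s1, inr s2, inr s3) = map4 inr w by case: (noS s1).
pose ss (s : S) : G := 0%R.
pose E := big_ext (midpoint m) e0 (@color_of m) (@mate m) (@ltG m) cube_ck cube_dk
  (cube_tk S) ss cube_mu cube_src (@upper m).
have hh := midpointD m; have h0 := midpoint_neq0 m.
pose Q' (l : part * G + S) := (l == embed None (drop_part l)) && Q (i (drop_part l)).
exists (part * G + S)%type, (big_f (midpoint m) fS), E, Q'; split.
- by rewrite card_sum card_prod card_option card_bool card_ord card_sig card0 addn0.
- by apply: big_f_fpf => //; apply: stem_f_fpf.
- have z2 (a : G) : (a == 0%R) || (a == midpoint m) -> two (midpoint m) a.
    by case/orP=> /eqP->; [left|right].
  have tks a s : cube_tk S a = SumStem s <-> ss s = a by case: (noS s).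
  apply: (@big_design _ _ _ _ _ _ _ _ _ _ _ _ _ _ _ _ true De0 sc (@ltG_asym m)
    (@color_ofC m) (@mate_color m) (@mate_neq m) (@color_of_mate m) _
    tks (@cube_mu_pair S) (@cube_mu_inv S) (@cube_src_mu S) (@cube_dk_src S)
    (@cube_dk_pair S) hh (@upper_midpoint m)).
  + move=> c o d; rewrite /cube_ck /cube_dk; case: ifP => _; split=> //;
    by case: ifP => // _; case: ifP.
  + by move=> c o; rewrite /cube_ck; case: eqP => // -> _; split=> // x; rewrite mate0.
  + by move=> _ x o; rewrite -mate0 color_of_mate.
  + move=> d; rewrite /cube_dk; case: ifP => [d2 _|_]; last by case: ifP.
    by split=> //; apply: z2.
  + by rewrite /cube_dk !eqxx orbT.
  + by move=> a; rewrite /cube_tk; case: ifP => // a2 _; split=> //; apply: z2.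
  + by rewrite /cube_tk !eqxx orbT.
- have -> : #|Q'| = #|[set embed None (r x) | x in Q] : {set part * G + S}|.
    apply: eq_card => l; apply/idP/imsetP => [/andP[/eqP lE Ql]|[x Qx ->]].
      by exists (i (drop_part l)); rewrite ?ik.
    by rewrite unfold_in /Q' embedK eqxx rk.
  rewrite card_imset // => x y /embed_inj; exact: (can_inj rk).
exact: embed_closed (@color_of m) (@mate m) (@ltG m) cube_ck cube_dk (cube_tk S) ss
  cube_mu cube_src (@upper m) sc _ cQ0.
Qed.

End CubeTripling.

Lemma tripling0 m : ~~ odd m -> has_design4 m.*2.+2 -> has_design4 (3 * m.*2.+2).
Proof.
move=> m_even [L [f [e [P [cardL f_inv De cardP cP]]]]].
have [L' [f' [e' [Q' [cL' fi' De' cQ' cQ]]]]] := cube_tripling m_even cardL f_inv De cP.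
by exists L', f', e', Q'; rewrite cQ'.
Qed.

(** * Designs given by tables *)

Lemma has_design2 : has_design 2.
Proof.
exists bool, negb, (fun=> (true, true, true, true)); split; first exact: card_bool.
  by split=> -[].
by move=> [[[] []] []].
Qed.

Lemma has_design6 : has_design 6.
Proof.
exists (part * bool)%type, flip, cube_ext; split; last exact: cube_ext_design.
  by rewrite card_prod card_option card_bool.
exact: flip_fpf.
Qed.

Lemma lookup_unique (L : eqType) (x0 : L) ws w u :
  uniq (flatten (map (@dels L) ws)) -> w \in ws -> u \in dels w -> lookup x0 ws u = w.
Proof.
elim: ws => [//|w0 ws IH] /=; rewrite cat_uniq => /and3P[_ /hasPn dis uq].
rewrite inE /lookup /=; case: ifP => uw0 /=.
  case/orP=> [/eqP-> //|wws] uw.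
  have /dis : u \in flatten (map (@dels L) ws) by apply/flattenP; exists (dels w); rewrite ?map_f.
  by rewrite /= uw0.
by case/orP=> [/eqP->|/IH H uw]; rewrite ?uw0 //; apply: H.
Qed.

Definition letters (w : nat * nat * nat * nat) : seq nat :=
  let: (a, b, c, d) := w in [:: a; b; c; d].
Definition triples q : seq (nat * nat * nat) :=
  [seq (ab, c) | ab <- [seq (a, b) | a <- iota 0 q, b <- iota 0 q], c <- iota 0 q].
(** [triples] is listed in this order, so one computed equality with a sorted list shows both that
    every essential triple is covered and that none is covered twice. *)
Definition lex3 (t u : nat * nat * nat) : bool :=
  let: (a, b, c) := t in let: (x, y, z) := u in
  (a < x) || ((a == x) && ((b < y) || ((b == y) && (c <= z)))).

Lemma table_design4 q n (f : nat -> nat) ws : 0 < q -> n + 4 = q ->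
  all (fun x => [&& f x < q, f x != x, f (f x) == x & (n <= x) ==> (n <= f x)]) (iota 0 q) ->
  all (fun w => all (gtn q) (letters w)) ws ->
  all (fun w => has (fun u => let: (a, b, c) := u in [&& n <= a, n <= b & n <= c]) (dels w)
                ==> all (leq n) (letters w)) ws ->
  sort lex3 (flatten (map (@dels _) ws)) = [seq t <- triples q | essential f t] ->
  has_design4 q.
Proof.
move=> q_gt0 nq /allP fq /allP wsq /allP wsn sE.
have pE : perm_eq (flatten (map (@dels _) ws)) [seq t <- triples q | essential f t].
  by rewrite -sE perm_sym perm_sort.
have uq : uniq (flatten (map (@dels _) ws)).
  rewrite (perm_uniq pE) filter_uniq // allpairs_uniq ?iota_uniq //.
    by rewrite allpairs_uniq ?iota_uniq // => -[a b] [a' b'] _ _ [-> ->].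
  by move=> [a b] [a' b'] _ _ [-> ->].
case: q q_gt0 nq fq wsq wsn {sE} pE => // q _ nq fq wsq wsn pE.
have fP (x : 'I_q.+1) := fq x; pose f' (x : 'I_q.+1) : 'I_q.+1 := inord (f x).
have xi (x : 'I_q.+1) : (x : nat) \in iota 0 q.+1 by rewrite mem_iota /=.
have f'E (x : 'I_q.+1) : f x = f' x by have /and4P[fx _ _ _] := fP x (xi x); rewrite inordK.
pose v (x : 'I_q.+1) : nat := x.
have vK : cancel v inord by move=> x; rewrite inord_val.
have cov t : essential f' t ->
    exists w, [/\ w \in ws, map3 v t \in dels w & w = map4 v (map4 inord w)].
  move=> et; have /flattenP[d /mapP[w wws ->] tw] : map3 v t \in flatten (map (@dels _) ws).
    rewrite (perm_mem pE) mem_filter (essential_map3 (f := f') _ (can_inj vK)) //.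
    by rewrite et; case: t {et} => [[a b] c]; rewrite /= !allpairs_f ?xi.
  exists w; split=> //; have := wsq w wws.
  case: w {wws tw} => [[[x y] z] u] /and5P[hx hy hz hu _] /=.
  by rewrite /v !inordK.
have wordP w : w \in ws -> word_of f (lookup 0 ws) w.
  move=> wws u uw; split; last exact: lookup_unique uq wws uw.
  have : u \in flatten (map (@dels _) ws).
    by apply/flattenP; exists (dels w); rewrite ?map_f.
  by rewrite (perm_mem pE) mem_filter => /andP[].
pose P (x : 'I_q.+1) := n <= x.
pose e (t : 'I_q.+1 * 'I_q.+1 * 'I_q.+1) := map4 (@inord q) (lookup 0 ws (map3 v t)).
exists 'I_q.+1, f', e, P; split; first by rewrite card_ord.
- split=> x; have /and4P[fx fn /eqP ff _] := fP x (xi x).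
    by apply: ord_inj; rewrite -!f'E ff.
  by rewrite -val_eqE /= -f'E.
- apply: (design_pullback (f := f) vK f'E) => t et.
  have [w [wws tw wE]] := cov t et; exists (map4 inord w); rewrite -wE //.
  exact: wordP.
- have -> : #|P| = #|[set inord (n + k) | k : 'I_4] : {set 'I_q.+1}|.
    apply: eq_card => x; apply/idP/imsetP => [nx|[k _ ->]].
      have nx' : n <= x by [].
      exists (inord (x - n)) => //; have hx := ltn_ord x.
      by apply: ord_inj; rewrite !inordK; lia.
    by rewrite unfold_in /P; have hk := ltn_ord k; rewrite inordK; lia.
  rewrite card_imset ?card_ord // => k k' /(congr1 (@nat_of_ord _)).
  have hk := ltn_ord k; have hk' := ltn_ord k'; rewrite !inordK; try lia.
  by move=> E; apply: ord_inj; lia.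
split=> [x Px|a b c et Pa Pb Pc].
  by have /and4P[_ _ _] := fP x (xi x); rewrite /P -f'E (Px : n <= x).
have [w [wws tw wE]] := cov _ et.
rewrite /e (lookup_unique 0 uq wws tw).
have := wsn w wws; have -> : has (fun u => let: (a, b, c) := u in
    [&& n <= a, n <= b & n <= c]) (dels w).
  by apply/hasP; exists (map3 v (a, b, c)); rewrite //= /v; apply/and3P.
have := wsq w wws; case: w {wws tw wE} => [[[x y] z] u] /= /and5P[hx hy hz hu _].
by case/and5P=> nx ny nz nu _; rewrite /P !inordK // nx ny nz nu.
Qed.

(* Words over Z/n followed by four extra letters n .. n+3; the shift by 1 of Z/n acts on
   the extra letters by the involution [tau]. The base words below were found by a
   computer search. *)
Definition shift_letter n (tau : nat -> nat) s x :=
  if x < n then (x + s) %% n else if odd s then n + tau (x - n) else x.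
(** In both tables [tau] commutes with this pairing, so the shifts preserve essential triples. *)
Definition partner n x :=
  if x < n then (x + n./2) %% n
  else n + nth 0 [:: 1; 0; 3; 2] (x - n).
(** The eight fixed words form a design on the four extra letters. With them, 8 + 6 * 32 = 200 words
    cover the 800 essential triples on 10 letters, and 8 + 14 * 92 = 1296 words the 5184 on 18
    letters. *)
Definition orbit_words n tau base :=
  [seq map4 (addn n) w | w <- [::
     (2, 0, 1, 2); (3, 0, 1, 3); (0, 2, 3, 0); (0, 3, 2, 1); (3, 1, 0, 2);
     (2, 1, 0, 3); (1, 3, 2, 0); (1, 2, 3, 1)]] ++
  [seq map4 (shift_letter n tau s) w | w <- base, s <- iota 0 n].

Lemma has_design4_10 : has_design4 10.
Proof.
pose base := [::
     (6, 1, 4, 6); (8, 1, 2, 8); (0, 9, 2, 8); (0, 8, 2, 9); (8, 9, 1, 4);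
     (8, 0, 6, 2); (8, 1, 6, 3); (0, 5, 9, 7); (0, 9, 6, 0); (8, 0, 1, 7);
     (0, 8, 7, 0); (0, 5, 2, 0); (0, 1, 4, 0); (8, 0, 5, 4); (0, 8, 5, 3);
     (6, 0, 9, 4); (0, 6, 8, 1); (0, 3, 6, 9); (6, 1, 9, 5); (0, 2, 6, 5);
     (0, 6, 4, 7); (0, 7, 4, 6); (0, 5, 1, 6); (0, 7, 9, 5); (0, 7, 1, 3);
     (0, 4, 9, 1); (0, 3, 4, 2); (0, 4, 5, 8); (6, 1, 2, 3); (0, 2, 4, 3);
     (6, 0, 3, 8); (6, 7, 0, 5)].
apply: (@table_design4 10 6 (partner 6) (orbit_words 6 (nth 0 [:: 1; 0; 3; 2]) base)).
- by [].
- by [].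
- by vm_compute.
- by vm_compute.
- by vm_compute.
- by vm_compute.
Qed.

Lemma has_design4_18 : has_design4 18.
Proof.
pose base := [::
     (15, 1, 10, 15); (14, 0, 13, 14); (0, 14, 10, 0); (0, 6, 16, 0); (0, 17, 8, 0);
     (0, 5, 11, 0); (0, 15, 12, 0); (0, 2, 3, 0); (0, 4, 13, 0); (0, 9, 1, 0);
     (15, 1, 14, 2); (0, 17, 13, 16); (0, 15, 14, 11); (15, 0, 6, 4); (0, 15, 8, 2);
     (15, 17, 0, 5); (15, 1, 0, 17); (0, 5, 15, 17); (0, 17, 5, 1); (15, 1, 9, 12);
     (15, 1, 8, 5); (15, 16, 0, 13); (14, 15, 0, 1); (14, 17, 1, 4); (0, 15, 4, 16);
     (0, 17, 10, 14); (0, 17, 11, 4); (0, 17, 3, 12); (0, 2, 17, 9); (0, 4, 15, 10);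
     (0, 15, 13, 9); (0, 15, 5, 7); (0, 15, 3, 1); (0, 10, 17, 2); (0, 12, 1, 17);
     (0, 4, 11, 17); (0, 3, 11, 15); (0, 16, 6, 17); (0, 7, 6, 15); (0, 1, 16, 15);
     (14, 1, 10, 17); (0, 14, 12, 15); (0, 8, 10, 15); (14, 0, 6, 2); (0, 16, 13, 7);
     (0, 12, 16, 9); (14, 0, 16, 12); (0, 14, 16, 5); (0, 16, 4, 14); (0, 14, 2, 13);
     (0, 7, 14, 9); (0, 7, 16, 10); (0, 14, 4, 7); (0, 3, 14, 6); (0, 14, 8, 1);
     (0, 5, 3, 16); (0, 2, 10, 16); (0, 9, 11, 16); (0, 8, 5, 14); (0, 6, 1, 14);
     (14, 0, 9, 5); (14, 1, 5, 2); (14, 1, 13, 6); (14, 1, 7, 9); (0, 2, 5, 12);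
     (0, 5, 2, 8); (0, 9, 6, 7); (0, 10, 6, 3); (0, 3, 9, 2); (0, 1, 7, 13);
     (0, 3, 7, 5); (0, 7, 3, 8); (0, 9, 12, 8); (0, 1, 8, 3); (0, 11, 8, 7);
     (0, 8, 4, 6); (0, 13, 6, 11); (0, 2, 1, 4); (0, 7, 11, 1); (0, 12, 2, 7);
     (0, 11, 2, 6); (0, 12, 11, 13); (0, 1, 2, 11); (0, 13, 10, 8); (0, 10, 9, 13);
     (0, 1, 5, 6); (0, 4, 12, 3); (0, 5, 10, 4); (0, 9, 3, 4); (0, 10, 11, 5);
     (0, 12, 6, 10); (0, 13, 12, 4)].
apply: (@table_design4 18 14 (partner 14) (orbit_words 14 (nth 0 [:: 2; 3; 0; 1]) base)).
- by [].
- by [].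
- by vm_compute.
- by vm_compute.
- by vm_compute.
- by vm_compute.
Qed.

(** * Existence of designs *)

Lemma has_design4W q : has_design4 q -> has_design q.
Proof. by case=> L [f [e [P [? ? ? _ _]]]]; exists L, f, e. Qed.

Lemma designs_exist q : 2 <= q -> ~~ odd q ->
  has_design q /\ (8 <= q -> has_design4 q).
Proof.
elim/ltn_ind: q => q IH q2 qe.
have from4 : has_design4 q -> has_design q /\ (8 <= q -> has_design4 q).
  by move=> Dq; split=> // ; apply: has_design4W.
have [q0|q4] := boolP (4 %| q).
  apply: from4; have [m qE] : exists m, q = 2 * m.*2.+2 by exists (q %/ 4 - 1); lia.
  rewrite qE; apply: doubling.
  by have [] := IH m.*2.+2 ltac:(lia) ltac:(lia) ltac:(lia).
have [->|n2] := eqVneq q 2; first by split=> //; apply: has_design2.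
have [->|n6] := eqVneq q 6; first by split=> //; apply: has_design6.
(* Tripling would reach 10 = 3 * 2 + 4 and 18 = 3 * 6 from 6 letters, where no subdesign on four
   letters is at hand. *)
have [q10|n10] := eqVneq q 10.
  by apply: from4; rewrite q10; apply: has_design4_10.
have [q18|n18] := eqVneq q 18.
  by apply: from4; rewrite q18; apply: has_design4_18.
apply: from4.
(* The residue decides which of (q - 2)/3, q/3 and (q - 4)/3 is the integer g = 2m + 2. In the
   second case g is 2 modulo 4, so m is even; in the last two the values already treated leave at
   least 8 letters in the smaller alphabet. *)
have : q %% 12 = 2 \/ q %% 12 = 6 \/ q %% 12 = 10 by lia.
case=> [r2|[r6|r10]].
- have [m qE] : exists m, q = 3 * m.*2.+2 + 2 by exists ((q - 2) %/ 6 - 1); lia.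
  rewrite qE; apply: tripling2.
  by have [] := IH (m.*2.+2 + 2) ltac:(lia) ltac:(lia) ltac:(lia).
- have [m qE] : exists m, q = 3 * m.*2.+2 by exists (q %/ 6 - 1); lia.
  rewrite qE; apply: tripling0; first by lia.
  by have [_] := IH m.*2.+2 ltac:(lia) ltac:(lia) ltac:(lia); apply; lia.
have [m qE] : exists m, q = 3 * m.*2.+2 + 4 by exists ((q - 4) %/ 6 - 1); lia.
rewrite qE; apply: tripling4; first by lia.
by have [_] := IH (m.*2.+2 + 4) ltac:(lia) ltac:(lia) ltac:(lia); apply; lia.
Qed.

(* Words of length 4 = word 4 q = word 3.+1 q; N(4,q,1) = N1 3 q. *)
Theorem theorem5p1 (q : nat) (hq : 2 <= q) (heven : ~~ odd q) :
  exists C : {set word 4 q},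
    [/\ corrects1 C,
        perfect1 C,
        del1_code C = [set: word 3 q],
        #|C| = N1 3 q
      & N1 3 q = q ^ 2 * (q + 2) %/ 4].
Proof.
have [[L [f [e [cardL [fK f_neq] De]]]] _] := designs_exist hq heven.
pose i (x : 'I_q) : L := enum_val (cast_ord (esym cardL) x).
pose r (x : L) : 'I_q := cast_ord cardL (enum_rank x).
have ik : cancel i r by move=> x; rewrite /r /i enum_valK cast_ordKV.
have rk : cancel r i by move=> x; rewrite /r /i cast_ordK enum_rankK.
pose f' x := r (f (i x)).
have fi x : f (i x) = i (f' x) by rewrite /f' rk.
apply: (@design_optimal_code q f' _ _ heven _ (design_bij ik rk fi De)); first by lia.
split=> x; first by rewrite /f' rk fK ik.
by rewrite /f' -(inj_eq (can_inj ik)) rk f_neq.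
Qed.
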